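(* Let $\mathbb F$ be a field and let $M\in\mathcal{W}^{*}_k(d)$ be $\mathbb{F}$-orientable. Then: (a) if $d\ne2k+1$, then $M$ is $\mathbb{F}$-tight; and (b) if $d=2k+1$, then $M$ is $\mathbb{F}$-tight if and only if $\displaystyle\beta_k(M;\mathbb{F})=\frac{\binom{n-k-3}{k+1}}{\binom{2k+3}{k+1}}$, where $n=f_0(M)$ is the number of vertices of $M$.
   Context: All simplicial complexes are finite and abstract, and the empty set is a face of each; isomorphic complexes are identified. For a finite set $\alpha$, $\overline\alpha$ is the complex of all subsets of $\alpha$ and $\partial\alpha$ the complex of all proper subsets of $\alpha$; $X*Y$ denotes the join, whose faces are the disjoint unions of faces of $X$ with faces of $Y$. If $X$ is a $d$-dimensional complex and $\overline\alpha*\partial\beta$ ($\alpha,\beta\ne\emptyset$ disjoint, $\dim\alpha+\dim\beta=d$, where $\dim\alpha=\#(\alpha)-1$) is the induced subcomplex of $X$ on $\alpha\sqcup\beta$ (if $\beta$ is a single element this means that $\alpha\in X$ and $\beta$ is a new vertex not in $X$), then $Y=(X\setminus(\overline\alpha*\partial\beta))\cup(\partial\alpha*\overline\beta)$ is said to be obtained from $X$ by the bistellar move $\alpha\mapsto\beta$, of index $\dim\beta$. $S^{d}_{d+2}$ denotes the standard $d$-sphere, i.e. $\partial\gamma$ with $\#(\gamma)=d+2$. For $0\le k\le d+1$, a $d$-dimensional complex is $k$-stellated if it can be obtained from $S^d_{d+2}$ by a finite sequence of bistellar moves, each of index $<k$ (by convention $S^d_{d+2}$ is the only $0$-stellated one);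 such complexes are triangulated spheres. The link of a vertex $x$ is $\mathrm{lk}_X(x)=\{\alpha\in X: x\notin\alpha,\ \alpha\sqcup\{x\}\in X\}$. For $0\le k\le d$, $\mathcal W_k(d)$ is the class of connected simplicial complexes of dimension $d$ all of whose vertex links are $k$-stellated $(d-1)$-spheres; its members are triangulated closed manifolds. A complex is $l$-neighbourly if any $l$ of its vertices form a face. $\mathcal W^*_k(d)$ is the class of $(k+1)$-neighbourly members of $\mathcal W_k(d)$. A $d$-dimensional simplicial complex $X$ is $\mathbb F$-tight if $X$ is connected and, for all induced subcomplexes $Y$ of $X$ (those containing every face of $X$ all of whose vertices are vertices of $Y$) and all $0\le j\le d$, the morphism $H_j(Y;\mathbb F)\to H_j(X;\mathbb F)$ induced by inclusion is injective. $\mathbb F$-orientable means orientable with respect to homology with coefficients in $\mathbb F$. $\beta_k(M;\mathbb F)=\dim_{\mathbb F}H_k(M;\mathbb F)$.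
   Formalization: In part (b) the case k = 0, d = 1 is excluded (k ≥ 1 is assumed), because there the claim fails: the triangle C_3 is F-tight with β_0 = 1, while the binomial quotient is 0; likewise the 6-cycle satisfies the formula but is not tight. *)

(* Defs.v *)
From HB Require Import structures.
From mathcomp Require Import all_boot all_order all_algebra.

Set Implicit Arguments.
Unset Strict Implicit.
Unset Printing Implicit Defensive.

Import GRing.Theory.

Local Open Scope ring_scope.

Section Complexes.

Variable V : finType.
Implicit Types (X Y : {set {set V}}) (s t W a b : {set V}) (x y : V) (k : nat).

Definition is_complex X : bool :=
  (set0 \in X) && [forall s in X, forall t : {set V}, (t \subset s) ==> (t \in X)].

(* Points of [V] that are not in [vertices X] serve as new vertices. *)
Definition vertices X : {set V} := [set x | [set x] \in X].

(* The dimension plus one, so that the complex [[set set0]] of dimension -1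
   (the link of a vertex of a 0-dimensional complex) needs no negative number. *)
Definition dimS X : nat := (\max_(s in X) #|s|)%N.

Definition induced X W : {set {set V}} := [set s in X | s \subset W].

Definition link X x : {set {set V}} := [set s in X | (x \notin s) && (x |: s \in X)].

Definition simplex a : {set {set V}} := powerset a.

Definition bdsimplex a : {set {set V}} := powerset a :\ a.

(* Only used for complexes with disjoint vertex sets. *)
Definition join X Y : {set {set V}} := [set s :|: t | s in X, t in Y].

(* When [b] is a singleton, the condition on the induced subcomplex says that
   [a] is a face of [X] and that the element of [b] is not a vertex of [X]. *)
Definition bistellar a b X Y : bool :=
  [&& a != set0, b != set0, [disjoint a & b],
      (#|a| + #|b| == (dimS X).+1)%N,
      induced X (a :|: b) == join (simplex a) (bdsimplex b)
    & Y == (X :\: join (simplex a) (bdsimplex b))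
             :|: join (bdsimplex a) (simplex b)].

Definition bistellar_lt k X Y : bool :=
  [exists a, exists b, bistellar a b X Y && (#|b|.-1 < k)%N].

Definition connected_complex X : Prop :=
  forall x y, x \in vertices X -> y \in vertices X ->
    connect [rel u v | [set u; v] \in X] x y.

Definition neighbourly l X : Prop :=
  forall s, s \subset vertices X -> #|s| = l -> s \in X.

End Complexes.

Definition relabel (V U : finType) (f : V -> U) (X : {set {set V}}) :
  {set {set U}} := [set f @: (s : {set V}) | s in X].

(* [stellatedS k m X]: [X] is a k-stellated sphere of dimension m - 1.
   Complexes are taken up to isomorphism, and the moves may use new vertices:
   they take place in an arbitrary finite vertex set [U], from which [X] is
   recovered by relabelling. *)
Definition stellatedS (k m : nat) (V : finType) (X : {set {set V}}) : Prop :=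
  exists (U : finType) (f : V -> U) (c : {set U}),
    [/\ {in vertices X &, injective f}, #|c| = m.+1
      & connect (@bistellar_lt U k) (bdsimplex c) (relabel f X)].

Definition in_W (k d : nat) (V : finType) (X : {set {set V}}) : Prop :=
  [/\ is_complex X, dimS X = d.+1, connected_complex X
    & forall x, x \in vertices X -> stellatedS k d (link X x)].

Definition in_Wstar (k d : nat) (V : finType) (X : {set {set V}}) : Prop :=
  in_W k d X /\ neighbourly k.+1 X.

Section Homology.

Variables (F : fieldType) (V : finType).
Implicit Types (X Y : {set {set V}}) (s t : {set V}) (j : nat).

Local Notation chain := {ffun {set V} -> F^o}.

Definition face_chain s : chain := [ffun t => (t == s)%:R].

Definition chains j X : {vspace chain} :=
  (\sum_(s in X | #|s| == j.+1) <[face_chain s]>)%VS.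

(* Faces are oriented by the enumeration order of [V]: [t] occurs in the
   boundary of [x |: t] with sign (-1)^i, where i is the number of vertices of
   [t] before [x].  The coefficient at the empty face is set to 0, so that the
   homology is the unreduced one. *)
Definition boundary_fun (c : chain) : chain :=
  [ffun t => if t == set0 then 0 else
     \sum_(x | x \notin t)
       (-1) ^+ #|[set y in t | (enum_rank y < enum_rank x)%N]| * c (x |: t)].

Fact boundary_fun_linear : linear boundary_fun.
Proof.
move=> a c c'; apply/ffunP=> t; rewrite !ffunE.
case: eqP => _; first by rewrite scaler0 addr0.
rewrite scaler_sumr -big_split; apply: eq_bigr => x _ /=.
by rewrite !ffunE mulrDr -scalerAr.
Qed.

HB.instance Definition _ :=
  GRing.isLinear.Build F chain chain _ boundary_fun boundary_fun_linear.

Definition boundary : 'End(chain) := linfun boundary_fun.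

Definition cycles j X : {vspace chain} := (chains j X :&: lker boundary)%VS.

Definition boundaries j X : {vspace chain} := (boundary @: chains j.+1 X)%VS.

(* The quotient of cycles by boundaries, realized on a complement of the
   boundaries in the cycles.  On cycles, [homology_class] is onto
   ([homology_class_surj]) with kernel the boundaries ([homology_class_eq]), and
   [homology_map] sends the class of a cycle of [Y] to its class in [X]
   ([homology_map_class]). *)
Definition homology j X : vectType F := subvs_of (cycles j X :\: boundaries j X).

Definition homology_class j X (z : chain) : homology j X :=
  vsproj _ (addv_pi1 (cycles j X) (boundaries j X) z).

Definition homology_map j Y X (h : homology j Y) : homology j X :=
  homology_class j X (vsval h).

Fact homology_class_surj j X (h : homology j X) :
  exists2 z, z \in cycles j X & homology_class j X z = h.
Proof.
exists (vsval h); first exact: subvP (diffvSl _ _) _ (subvsP h).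
rewrite /homology_class /addv_pi1 daddv_pi_id ?vsvalK ?subvsP //.
exact: capv_diff.
Qed.

Fact homology_class_eq j X (z z' : chain) :
  z \in cycles j X -> z' \in cycles j X ->
  homology_class j X z = homology_class j X z' <-> z - z' \in boundaries j X.
Proof.
move=> Zz Zz'; have Zd: z - z' \in cycles j X by rewrite memvB.
have dZ : z - z' \in (cycles j X + boundaries j X)%VS.
  by rewrite (subvP (addvSl _ _)).
rewrite /homology_class; split=> [/(congr1 vsval) | dB].
  rewrite !vsprojK ?memv_pi // => e.
  rewrite -(addv_pi1_pi2 dZ) linearB /= e subrr add0r; exact: memv_pi2.
congr vsproj; apply/eqP; rewrite -subr_eq0 -linearB; apply/eqP.
by apply: (addIr (z - z')); rewrite add0r -[RHS](addv_pi1_pi2 dZ) addv_pi2_id.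
Qed.

Fact homology_map_class j Y X (z : chain) :
  Y \subset X -> z \in cycles j Y ->
  homology_map X (homology_class j Y z) = homology_class j X z.
Proof.
move=> sYX Zz.
have sCC i : (chains i Y <= chains i X)%VS.
  apply/subv_sumP => s /andP[sY si]; apply: (sumv_sup s) => //.
  by rewrite (subsetP sYX).
have sBB : (boundaries j Y <= boundaries j X)%VS := limgS _ (sCC _).
have sZZ : (cycles j Y <= cycles j X)%VS := capvS (sCC _) (subvv _).
set h := homology_class j Y z.
have Zh : vsval h \in cycles j Y := subvP (diffvSl _ _) _ (subvsP h).
apply/homology_class_eq; rewrite ?(subvP sZZ) //; apply: (subvP sBB).
apply/homology_class_eq => //.
rewrite /homology_class /addv_pi1 daddv_pi_id ?vsvalK ?subvsP //.
exact: capv_diff.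
Qed.

Definition betti j X : nat := \dim {: homology j X}.

Definition tight X : Prop :=
  connected_complex X /\
  forall (W : {set V}) j, (j < dimS X)%N ->
    injective (@homology_map j (induced X W) X).

(* Only used for connected closed triangulated manifolds of dimension d, for
   which it says that the top homology is a copy of F. *)
Definition orientable d X : Prop := betti d X = 1%N.

End Homology.

(* Main.v *)
From HB Require Import structures.
Require Import Defs.
From mathcomp Require Import all_boot all_order all_algebra zify ring.

Set Implicit Arguments.
Unset Strict Implicit.
Unset Printing Implicit Defensive.

Import Order.TTheory GRing.Theory Num.Theory.

Local Open Scope ring_scope.

(** Write M[W] for the subcomplex of M induced on W.  Tightness says that a
    chain of M[W] that bounds in M already bounds in M[W] ([tightE]).  Adding
    the vertices outside W one at a time reduces this to single steps: M[W + x]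
    is M[W] together with the faces t such that x is in t and t is contained in
    W + x, and the homology of this open star is that of the induced subcomplex
    lk(x)[W] of the link, with degrees shifted.  So a step is injective in
    degree j as soon as the reduced homology of lk(x)[W] vanishes in degree j
    ([injects_step]); and it is injective for a trivial reason when that of
    M[W] vanishes in degree j ([injects_vanishes]).

    Three vanishing results feed this.  (1) M[W] has a complete k-skeleton, so
    it has no reduced homology below degree k ([skeleton_vanishes]).  (2) A
    k-stellated (d-1)-sphere S arises from a standard sphere by adding cells of
    dimension less than k and removing cells of dimension more than d - 1 - k,
    up to homology equivalence, and this holds for all its induced subcomplexes
    alike; hence they have no homology in degrees k, ..., d - k - 2
    ([middle_vanishes]).  (3) The link is also k-neighbourly, and a proper
    induced subcomplex of a k-neighbourly (d-1)-sphere has no homology above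
    degree d - 1 - k ([neighbourly_vanishes]).  Alexander duality would give
    (3); here it is proved by adding vertices until one is left out, the links
    met on the way being less neighbourly spheres of smaller dimension.  All
    that is needed of spheres is that the open stars of a face and of any larger
    face have the same homology; this property is called [star_acyclic], and
    [flip_star_acyclic] shows that bistellar moves preserve it.  What is left is
    the last vertex in degree d - 1, where orientability enters: the fundamental
    cycle restricts to a top cycle of the star of that vertex, unique up to a
    factor ([orient_injects]).  Together these give injectivity in all degrees
    except j = k when d = 2k + 1 ([all_injects]).

    Let d = 2k + 1.  Since M[W] has a complete k-skeleton, its k-th Betti number
    is determined by the rank r(W) of its boundary map from degree k + 1 to
    degree k.  Adding x raises r by at least the rank of the same map on the
    open star, with equality exactly when the step is injective ([rk_cut]).
    Average these inequalities over all orderings of the vertices: the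
    differences of r telescope to r(M), that is, to the Betti number
    ([telescope], [betti_rk]), so M is tight if and only if the Betti number
    equals an average over the links that has to be computed
    ([injects_betti]).  Each link S is a k-stellated 2k-sphere, and performing
    its bistellar moves one dimension up, by gluing in a full simplex for each,
    gives a ball B with boundary S.  All faces of B of dimension at most k are
    in S, and no induced subcomplex of B has homology in degrees k and above
    ([filling], [filling_exists]).  So the rank in question is an alternating
    sum of face numbers of B[A] ([filling_rank]); averaging replaces it by an
    alternating sum of face numbers of B, which are determined by the number of
    vertices because S is k-neighbourly ([average_rank]). *)

(** * Chains of convex families of sets *)

Section Cells.

Variable T : finType.
Implicit Types (Q D U : {set {set T}}) (s t p q w : {set T}) (y : T).

Definition cells n Q : {set {set T}} := [set t in Q | #|t| == n].

(** Convexity is what makes the boundary truncated to [Q] a differential.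
    Complexes, open stars and differences of complexes are convex, and all the
    homology below is that of convex families. *)
Definition convex Q : Prop :=
  forall s t u, s \in Q -> u \in Q -> s \subset t -> t \subset u -> t \in Q.

(** A pair in the sense of homology: [D] is closed in [Q], and [U] carries the
    chains of [Q] modulo [D]. *)
Definition cut Q D U : Prop :=
  [/\ convex Q, Q = D :|: U & forall s t, s \in U -> t \in D -> ~~ (s \subset t)].

Lemma cellsP n Q t : reflect (t \in Q /\ #|t| = n) (t \in cells n Q).
Proof. by rewrite inE; apply: (iffP andP) => -[? /eqP]. Qed.

Lemma cutL Q D U t : cut Q D U -> t \in D -> t \in Q.
Proof. by case=> _ -> _ tD; rewrite inE tD. Qed.

Lemma cutR Q D U t : cut Q D U -> t \in U -> t \in Q.
Proof. by case=> _ -> _ tU; rewrite inE tU orbT. Qed.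

Lemma cut_disjoint Q D U t : cut Q D U -> t \in U -> (t \in D) = false.
Proof. by case=> _ _ h tU; apply/negP => tD; have := h _ _ tU tD; rewrite subxx. Qed.

Lemma cutE Q D U t : cut Q D U -> (t \in Q) = (t \in D) || (t \in U).
Proof. by case=> _ -> _; rewrite inE. Qed.

Lemma cut_up Q D U s t : cut Q D U -> s \in U -> t \in Q -> s \subset t -> t \in U.
Proof.
move=> h sU tQ st; move: tQ; rewrite (cutE _ h) => /orP[tD|//].
by case: h => _ _ /(_ _ _ sU tD); rewrite st.
Qed.

End Cells.

Section Chains.

Variables (F : fieldType) (T : finType).
Implicit Types (Q D U E : {set {set T}}) (s t p q w : {set T}) (y : T).

Local Notation chain := {ffun {set T} -> F^o}.

Definition restr Q (c : chain) : chain := [ffun t => if t \in Q then c t else 0].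

Lemma restr_linear Q : linear (restr Q).
Proof.
move=> a c c'; apply/ffunP => t; rewrite !ffunE.
by case: ifP; rewrite ?scaler0 ?addr0.
Qed.

HB.instance Definition _ Q :=
  GRing.isLinear.Build F chain chain _ (restr Q) (restr_linear Q).

Definition span_cells E : {vspace chain} :=
  (\sum_(s in E) <[face_chain F s]>)%VS.

Lemma face_chainE s t : face_chain F s t = (t == s)%:R.
Proof. by rewrite ffunE. Qed.

Lemma chain_sum (c : chain) : c = \sum_s c s *: face_chain F s.
Proof.
apply/ffunP => t; rewrite sum_ffunE (bigD1 t) //= big1 ?addr0; last first.
  by move=> s ns; rewrite !ffunE eq_sym (negPf ns) scaler0.
by rewrite !ffunE eqxx /GRing.scale /= mulr1.
Qed.

Lemma span_cellsP E (c : chain) :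
  reflect (forall t, t \notin E -> c t = 0) (c \in span_cells E).
Proof.
apply: (iffP idP) => [/memv_sumP[v vE ->] t tE | h].
  rewrite sum_ffunE big1 // => s sE.
  have /vlineP[a ->] := vE _ sE.
  rewrite !ffunE; case: eqP => [e|_]; last by rewrite scaler0.
  by move: tE; rewrite e sE.
rewrite (chain_sum c) (bigID (mem E)) /= [X in _ + X]big1 ?addr0 => [|s sE].
  apply: memv_suml => s sE; apply: subvP (sumv_sup s sE (subvv _)) _ _.
  by rewrite memvZ ?memv_line.
by rewrite h ?scale0r.
Qed.

Lemma restr_id E (c : chain) : c \in span_cells E -> restr E c = c.
Proof.
move/span_cellsP => h; apply/ffunP => t; rewrite ffunE.
by case: ifPn => // /h.
Qed.

Lemma dim_span_cells E : \dim (span_cells E) = #|E|.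
Proof.
have nz s : face_chain F s != 0.
  by apply/eqP => /ffunP/(_ s); rewrite !ffunE eqxx => /eqP; rewrite oner_eq0.
have dir : directv (\sum_(s in E) <[face_chain F s]>)%VS.
  apply/directv_sum_independent => v vE /ffunP v0 s sE.
  have h s' : s' \in E -> v s' s = if s' == s then v s s else 0.
    move=> sE'; case: eqP => [->//|ns]; have /vlineP[a ->] := vE _ sE'.
    by rewrite !ffunE; case: eqP => [e|_]; [case: ns|rewrite scaler0].
  have := v0 s; rewrite sum_ffunE (eq_bigr _ h) -big_mkcondr /= (bigD1 s) ?sE ?eqxx //=.
  rewrite big1 ?addr0 => [vs|i /andP[/andP[_ /eqP->]]]; last by rewrite eqxx.
  have /vlineP[a e] := vE _ sE; have a0 : a = 0.
    by move: vs; rewrite e !ffunE eqxx /GRing.scale /= mulr1.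
  by rewrite e a0 scale0r.
rewrite /span_cells; move/directvP: dir => /= ->.
rewrite -sum1_card; apply: eq_bigr => s _.
by rewrite dim_vline nz.
Qed.

End Chains.

(** All that the arguments use of an orientation.  The signs are kept abstract
    so that those on the star of a vertex of a manifold can be transplanted to
    the complex, on other points, in which the link is known to be
    stellated. *)
Definition incidence (F : fieldType) (T : finType) (sg : {set T} -> T -> F) : Prop :=
  (forall s x, sg s x * sg s x = 1) /\
  (forall (s : {set T}) (x y : T), x \notin s -> y \notin s -> x != y ->
     sg s x * sg (x |: s) y = - (sg s y * sg (y |: s) x)).

Section Boundary.

Variables (F : fieldType) (T : finType) (sg : {set T} -> T -> F).
Implicit Types (Q D U E X : {set {set T}}) (s t p q w r A : {set T}) (x y : T).

Local Notation chain := {ffun {set T} -> F^o}.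
Implicit Types b c : chain.

(** The empty face is a cell, so this is the augmented boundary, and the degree
    of a chain is the number of points of its faces, one more than their
    dimension. *)
Definition bd c : chain := [ffun t : {set T} => \sum_(x | x \notin t) sg t x * c (x |: t)].

Lemma bd_linear : linear bd.
Proof.
move=> a c c'; apply/ffunP => t; rewrite !ffunE scaler_sumr -big_split.
apply: eq_bigr => x _ /=; by rewrite !ffunE mulrDr /GRing.scale /= mulrCA.
Qed.

HB.instance Definition _ :=
  GRing.isLinear.Build F chain chain _ bd bd_linear.

Definition rbd Q : {linear chain -> chain} := restr Q \o bd.

Lemma rbdE Q c t : rbd Q c t = if t \in Q then bd c t else 0.
Proof. by rewrite /= ffunE. Qed.

(** The reduced homology of [Q] in dimension [n] - 1 is zero, in the form that
    suits diagram chasing.  [vanishes_card] gives the numerical form. *)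
Definition vanishes n Q : Prop :=
  forall c, c \in span_cells F (cells n Q) -> rbd Q c = 0 ->
  exists2 b, b \in span_cells F (cells n.+1 Q) & rbd Q b = c.

Definition acyclic Q : Prop := forall n, vanishes n Q.

Definition rk n Q : nat := \dim (linfun (rbd Q) @: span_cells F (cells n Q))%VS.

Lemma bd_deg n E c t : c \in span_cells F (cells n E) -> (#|t|.+1 != n)%N -> bd c t = 0.
Proof.
move/span_cellsP => h tn; rewrite ffunE big1 // => x xt.
rewrite h ?mulr0 // inE negb_and cardsU1 xt add1n tn; exact: orbT.
Qed.

Lemma span_sub E E' c : c \in span_cells F E -> E \subset E' -> c \in span_cells F E'.
Proof.
move=> /span_cellsP h /subsetP sE; apply/span_cellsP => t tE'.
by apply: h; apply: contra tE'; apply: sE.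
Qed.

Lemma cellsS n Q : cells n Q \subset Q.
Proof. by apply/subsetP => t /cellsP[]. Qed.

Lemma span_cellsW n Q c : c \in span_cells F (cells n Q) -> c \in span_cells F Q.
Proof. by move=> /span_sub; apply; apply: cellsS. Qed.

Lemma span_cells_mono n Q Q' c : Q \subset Q' ->
  c \in span_cells F (cells n Q) -> c \in span_cells F (cells n Q').
Proof.
move=> /subsetP sQ /span_sub; apply; apply/subsetP => t /cellsP[tQ tn].
by apply/cellsP; split=> //; apply: sQ.
Qed.

Lemma span_cellsI n Q Q' c : c \in span_cells F (cells n Q) ->
  c \in span_cells F Q' -> c \in span_cells F (cells n Q').
Proof.
move=> /span_cellsP h1 /span_cellsP h2; apply/span_cellsP => t.
rewrite inE negb_and => /orP[|tn]; first exact: h2.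
by apply: h1; rewrite inE negb_and tn orbT.
Qed.

Lemma rbd_span_n n E Q c : c \in span_cells F (cells n.+1 E) ->
  rbd Q c \in span_cells F (cells n Q).
Proof.
move=> h; apply/span_cellsP => t; rewrite rbdE; case: ifP => // tQ.
by rewrite inE tQ /= => tn; apply: bd_deg h _; rewrite eqSS.
Qed.

Lemma restr_n n Q E c : c \in span_cells F (cells n Q) ->
  restr E c \in span_cells F (cells n E).
Proof.
move=> /span_cellsP h; apply/span_cellsP => t.
rewrite ffunE; case: ifP => // tE; rewrite inE tE /= => tn.
by apply: h; rewrite inE negb_and tn orbT.
Qed.

Hypothesis sgP : incidence sg.

(** The two orders of each pair are added explicitly, because in characteristic
    2 an antisymmetric sum is not zero by sign change alone. *)
Lemma sum_antisym0 (P : pred T) (f : T -> T -> F) :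
  (forall x y, P x -> P y -> x != y -> f x y = - f y x) ->
  \sum_(x | P x) \sum_(y | P y && (y != x)) f x y = 0.
Proof.
move=> h; pose lt x y := (enum_rank x < enum_rank y)%N.
have spl x : P x -> \sum_(y | P y && (y != x)) f x y =
   \sum_(y | P y && lt x y) f x y - \sum_(y | P y && lt y x) f y x.
  move=> Px; rewrite (bigID (lt x)) /= -sumrN; congr (_ + _).
    by apply: eq_bigl => y; rewrite -andbA; case: eqP => //= ->; rewrite /lt ltnn.
  have e y : P y && (y != x) && ~~ lt x y = P y && lt y x.
    rewrite -andbA; congr (_ && _); rewrite /lt -leqNgt ltn_neqAle; congr (_ && _).
    by rewrite (inj_eq (@ord_inj _)) (inj_eq enum_rank_inj).
  rewrite (eq_bigl _ _ e); apply: eq_bigr => y /andP[Py xy].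
  by apply: h => //; apply: contraTneq xy => ->; rewrite /lt ltnn.
rewrite (eq_bigr _ spl) sumrB; apply/eqP; rewrite subr_eq0; apply/eqP.
rewrite (exchange_big_dep P) /=; last by move=> x y _ /andP[].
by apply: eq_bigr => y Py; apply: eq_bigl => x; rewrite Py.
Qed.

Lemma bd_bd c : bd (bd c) = 0.
Proof.
apply/ffunP => r; rewrite !ffunE.
rewrite (eq_bigr (fun x => \sum_(y | (y \notin r) && (y != x))
   sg r x * (sg (x |: r) y * c (y |: (x |: r))))); last first.
  move=> x xr; rewrite ffunE big_distrr /=; apply: eq_bigl => y.
  by rewrite in_setU1 negb_or andbC.
apply: sum_antisym0 => x y xr yr xy.
by rewrite !mulrA setUCA; case: sgP => _ ->; rewrite // mulNr.
Qed.

Lemma rbd_rbd Q c : convex Q -> c \in span_cells F Q -> rbd Q (rbd Q c) = 0.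
Proof.
move=> cQ /span_cellsP cs; apply/ffunP => r; rewrite rbdE [RHS]ffunE.
case: ifP => // rQ; rewrite -[RHS](_ : bd (bd c) r = _); last by rewrite bd_bd ffunE.
rewrite [LHS]ffunE [RHS]ffunE; apply: eq_bigr => x xr; congr (_ * _).
rewrite rbdE; case: ifPn => // xQ; rewrite ffunE big1 // => y yx.
rewrite cs ?mulr0 //; apply: contra xQ => uQ.
by apply: cQ rQ uQ _ _; rewrite ?subsetUr // setUCA subsetUr.
Qed.

Lemma rbdB Q b c : rbd Q (b - c) = rbd Q b - rbd Q c.
Proof. exact: linearB. Qed.

Lemma rbdD Q b c : rbd Q (b + c) = rbd Q b + rbd Q c.
Proof. exact: linearD. Qed.

Section Cut.

Variables Q D U : {set {set T}}.
Hypothesis hc : cut Q D U.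

Lemma cutSL : D \subset Q. Proof. by apply/subsetP => t; apply: cutL hc. Qed.
Lemma cutSR : U \subset Q. Proof. by apply/subsetP => t; apply: cutR hc. Qed.

Lemma restr_rbd_cut c : c \in span_cells F Q -> restr U (rbd Q c) = rbd U (restr U c).
Proof.
move=> /span_cellsP cs; apply/ffunP => t; rewrite !rbdE ffunE rbdE.
case: ifP => // tU; rewrite (cutR hc tU) !ffunE; apply: eq_bigr => x _.
congr (_ * _); rewrite ffunE; case: ifPn => // xU; apply: cs.
by apply: contra xU => xQ; apply: cut_up hc tU xQ (subsetUr _ _).
Qed.

Lemma rbd_cutL c : c \in span_cells F D -> rbd Q c = rbd D c.
Proof.
move=> /span_cellsP cs; apply/ffunP => t; rewrite !rbdE (cutE _ hc).
case tD: (t \in D) => //=; case: ifP => // tU; rewrite ffunE big1 // => x _.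
rewrite cs ?mulr0 //; apply/negP => xD; case: hc => _ _ /(_ _ _ tU xD).
by rewrite subsetUr.
Qed.

Lemma span_cutD c : c \in span_cells F Q -> restr U c = 0 -> c \in span_cells F D.
Proof.
move=> /span_cellsP cs /ffunP c0; apply/span_cellsP => t tD.
case tU: (t \in U); first by have := c0 t; rewrite !ffunE tU.
by apply: cs; rewrite (cutE _ hc) (negPf tD) tU.
Qed.

Lemma span_cells_cutD n c : c \in span_cells F (cells n Q) -> restr U c = 0 ->
  c \in span_cells F (cells n D).
Proof.
by move=> cn c0; apply: (span_cellsI cn); apply: span_cutD c0; apply: span_cellsW cn.
Qed.

Lemma restr_cutL c : c \in span_cells F D -> restr U c = 0.
Proof.
move=> /span_cellsP cs; apply/ffunP => t; rewrite !ffunE; case: ifP => // tU.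
by rewrite cs // (cut_disjoint hc tU).
Qed.

(** This lemma and the next two are exactness of the long homology sequence of
    the pair: in each, the two neighbours of a term vanish. *)
Lemma vanishes_cut n : vanishes n D -> vanishes n U -> vanishes n Q.
Proof.
move=> vD vU c cn c0.
have [b1 b1n e1] : exists2 b, b \in span_cells F (cells n.+1 U) & rbd U b = restr U c.
  apply: vU; first exact: restr_n cn.
  by rewrite -(restr_rbd_cut (span_cellsW cn)) c0 linear0.
have b1Q := span_cells_mono cutSR b1n.
have dn : c - rbd Q b1 \in span_cells F (cells n D).
  apply: span_cells_cutD; first by rewrite memvB // (rbd_span_n _ b1Q).
  rewrite linearB /= [restr U (restr Q _)](restr_rbd_cut (span_cellsW b1Q)).
  by rewrite (restr_id (span_cellsW b1n)) e1 subrr.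
have [|b2 b2n e2] := vD _ dn.
  rewrite -(rbd_cutL (span_cellsW dn)) rbdB c0 rbd_rbd ?subrr //; first by case: hc.
  exact: span_cellsW b1Q.
exists (b1 + b2); first by rewrite memvD // (span_cells_mono cutSL).
by rewrite rbdD (rbd_cutL (span_cellsW b2n)) e2 addrC subrK.
Qed.

Lemma vanishes_lower n : vanishes n Q -> vanishes n.+1 U -> vanishes n D.
Proof.
move=> vQ vU c cn c0; have cW := span_cellsW cn.
have [|b bn eb] := vQ c (span_cells_mono cutSL cn); first by rewrite rbd_cutL.
have [||b1 b1n e1] := vU (restr U b).
- exact: restr_n bn.
- by rewrite -restr_rbd_cut ?(span_cellsW bn) // eb restr_cutL.
have b1Q := span_cells_mono cutSR b1n.
have dn : b - rbd Q b1 \in span_cells F (cells n.+1 D).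
  apply: span_cells_cutD; first by rewrite memvB // (rbd_span_n _ b1Q).
  rewrite linearB /= [restr U (restr Q _)](restr_rbd_cut (span_cellsW b1Q)).
  by rewrite (restr_id (span_cellsW b1n)) e1 subrr.
exists (b - rbd Q b1) => //.
rewrite -(rbd_cutL (span_cellsW dn)) rbdB eb rbd_rbd ?subr0 //; first by case: hc.
exact: span_cellsW b1Q.
Qed.

Lemma vanishes_upper n : vanishes n.+1 Q -> vanishes n D -> vanishes n.+1 U.
Proof.
move=> vQ vD c cn c0; have cQ := span_cells_mono cutSR cn.
have dn : rbd Q c \in span_cells F (cells n D).
  apply: span_cells_cutD; first exact: rbd_span_n cQ.
  by rewrite restr_rbd_cut ?(span_cellsW cQ) // (restr_id (span_cellsW cn)).
have [|e en ee] := vD _ dn.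
  rewrite -(rbd_cutL (span_cellsW dn)) rbd_rbd //; first by case: hc.
  exact: span_cellsW cQ.
have eQ := span_cells_mono cutSL en.
have [||b bn eb] := vQ (c - e); first by rewrite memvB.
  by rewrite rbdB (rbd_cutL (span_cellsW en)) ee subrr.
exists (restr U b); first exact: restr_n bn.
rewrite -restr_rbd_cut ?(span_cellsW bn) // eb linearB /=.
by rewrite (restr_cutL (span_cellsW en)) subr0 (restr_id (span_cellsW cn)).
Qed.

Lemma rbd0 (R E : {set {set T}}) c : c \in span_cells F (cells 0 E) -> rbd R c = 0.
Proof.
by move=> cn; apply/ffunP => t; rewrite rbdE (bd_deg cn) // ffunE if_same.
Qed.

Lemma acyclic_cut : acyclic D -> acyclic U -> acyclic Q.
Proof. by move=> hD hU n; apply: vanishes_cut. Qed.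

Lemma acyclic_lower : acyclic Q -> acyclic U -> acyclic D.
Proof. by move=> hQ hU n; apply: vanishes_lower. Qed.

End Cut.

(** The family is a cone with apex [y]: adding [y] to the faces of a chain is a
    contracting homotopy. *)
Lemma cone_acyclic Q y :
  (forall t, y \notin t -> (y |: t \in Q) = (t \in Q)) -> acyclic Q.
Proof.
move=> tog n c cn c0; case: (sgP) => sg2 sgA.
pose b : chain := [ffun t : {set T} => if y \in t then sg (t :\ y) y * c (t :\ y) else 0].
exists b.
  apply/span_cellsP => t tn; rewrite ffunE; case: ifP => // yt.
  move/span_cellsP: cn => ->; rewrite ?mulr0 //; apply: contra tn => /cellsP[tQ tn].
  apply/cellsP; rewrite -(setD1K yt) tog ?setD11 //; split=> //.
  by rewrite cardsU1 setD11 tn.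
apply/ffunP => t; rewrite rbdE; case: ifPn => tQ; last first.
  by move/span_cellsP: (span_cellsW cn) => ->.
have cr r : r \in Q -> \sum_(x | x \notin r) sg r x * c (x |: r) = 0.
  by move=> rQ; move/ffunP: c0 => /(_ r); rewrite rbdE rQ !ffunE.
rewrite ffunE; case yt: (y \in t); last first.
  rewrite (bigD1 y) ?yt //= big1 ?addr0.
    by rewrite ffunE setU11 setU1K ?yt // mulrA sg2 mul1r.
  move=> x /andP[_ xy]; rewrite ffunE in_setU1 yt eq_sym (negPf xy) /= mulr0 //.
pose r := t :\ y; have yr : y \notin r by rewrite setD11.
have tE : t = y |: r by rewrite setD1K.
have rQ : r \in Q by rewrite -tog // -tE.
have key x : x \notin t -> sg t x * b (x |: t) = - (sg r y * (sg r x * c (x |: r))).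
  move=> xt; have xy : x != y by apply: contraNneq xt => ->.
  have xr : x \notin r by apply: contra xt; rewrite inE => /andP[].
  rewrite ffunE in_setU1 yt orbT.
  have -> : (x |: t) :\ y = x |: r.
    by apply/setP => z; rewrite !inE; case: eqP => [->|] //=; rewrite orbF eq_sym (negPf xy).
  have -> : sg t x = - (sg r y * (sg r x * sg (x |: r) y)).
    by rewrite (sgA r x y) // mulrN opprK mulrA sg2 mul1r tE.
  by rewrite mulNr -!mulrA [sg (x |: r) y * (_ * c _)]mulrA sg2 mul1r.
rewrite (eq_bigr _ key) sumrN -big_distrr /=.
have := cr r rQ; rewrite (bigD1 y) //= -tE => /eqP; rewrite addrC addr_eq0 => /eqP e.
have -> : \sum_(x | x \notin t) sg r x * c (x |: r) =
          \sum_(x | (x \notin r) && (x != y)) sg r x * c (x |: r).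
  by apply: eq_bigl => x; rewrite tE in_setU1 negb_or andbC.
by rewrite e mulrN opprK mulrA sg2 mul1r.
Qed.

(** Homology in one degree sees only the cells of that degree and of the two
    adjacent ones. *)
Lemma vanishes_eq n Q Q' :
  (forall t, (n <= #|t|.+1)%N -> (#|t| <= n.+1)%N -> (t \in Q) = (t \in Q')) ->
  vanishes n Q -> vanishes n Q'.
Proof.
move=> h v c cn c0.
have hc m d : (n <= m.+1)%N -> (m <= n.+1)%N ->
    (d \in span_cells F (cells m Q)) = (d \in span_cells F (cells m Q')).
  move=> h1 h2; congr (_ \in span_cells F _); apply/setP => t.
  rewrite !inE; case: eqP => [tm|]; rewrite ?andbF // !andbT; apply: h; by rewrite tm.
have hr m d : (n <= m)%N -> (m <= n.+1)%N -> d \in span_cells F (cells m Q) -> rbd Q d = rbd Q' d.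
  move=> h1 h2 dm; apply/ffunP => t; rewrite !rbdE.
  have [e|ne] := eqVneq (#|t|.+1) m; last by rewrite (bd_deg dm) // !if_same.
  by rewrite h ?e // (leq_trans _ h2) // -e.
have cn' : c \in span_cells F (cells n Q) by rewrite hc.
have [|b bn eb] := v c cn'; first by rewrite (hr n).
have n2 : (n <= n.+2)%N by rewrite !leqW.
by exists b; [rewrite -hc | rewrite -(hr n.+1)].
Qed.

Lemma vanishes_nocells n Q : (forall t, t \in Q -> #|t| <> n) -> vanishes n Q.
Proof.
move=> h c /span_cellsP cn _; exists 0; rewrite ?mem0v // linear0.
apply/ffunP => t; rewrite ffunE cn //; apply/negP => /cellsP[tQ]; exact: h.
Qed.

Lemma not_vanishes_single t : ~ vanishes #|t| [set t].
Proof.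
move=> v; have fn : face_chain F t \in span_cells F (cells #|t| [set t]).
  apply/span_cellsP => s sn; rewrite face_chainE; case: eqP sn => // ->.
  by rewrite !inE !eqxx.
have [|b bn eb] := v _ fn.
  apply/ffunP => s; rewrite rbdE inE; case: eqP => [->|]; last by rewrite ffunE.
  by rewrite (bd_deg fn) ?ffunE // neq_ltn ltnSn orbT.
have b0 : b = 0.
  apply/ffunP => s; move/span_cellsP: bn => ->; first by rewrite ffunE.
  by rewrite !inE; case: eqP => [->|] //=; rewrite neq_ltn ltnSn.
have /ffunP/(_ t)/eqP := eb; rewrite b0 linear0 !ffunE eqxx eq_sym.
by rewrite oner_eq0.
Qed.

End Boundary.

(** * Bistellar moves preserve homological sphericity *)

Section Moves.

Variable T : finType.
Implicit Types (X Y Q D U : {set {set T}}) (a b s t u p w A : {set T}) (x y z : T).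

(** A bistellar move read off membership.  Inside the simplex on [a :|: b], the
    faces missing from [X] are those above [b], and the faces missing from [Y]
    are those above [a]; so [X] and [Y] become equal when that simplex is
    filled in, which is how they are compared below. *)
Definition flip a b X Y : Prop :=
  [/\ a != set0, b != set0, [disjoint a & b],
      forall t, t \subset a :|: b -> (t \in X) = ~~ (b \subset t)
    & forall t, (t \in Y) = if t \subset a :|: b then ~~ (a \subset t) else t \in X].

(** The open star of [s] without that of [u].  It is acyclic when the two open
    stars have the same homology. *)
Definition star X s u : {set {set T}} :=
  [set t in X | (s \subset t) && ~~ (u \subset t)].

(** For [p] the union of [s] and [b], what filling the simplex on [w] adds to
    [star X s u]. *)
Definition box_minus p w u : {set {set T}} :=
  [set t : {set T} | [&& p \subset t, t \subset w & ~~ (u \subset t)]].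

Lemma complex_sub X s t : is_complex X -> t \in X -> s \subset t -> s \in X.
Proof.
by move=> /andP[_ /forall_inP h] /h /forallP/(_ s)/implyP; apply.
Qed.

Lemma complex_set0 X : is_complex X -> set0 \in X.
Proof. by case/andP. Qed.

Lemma complexI X : set0 \in X -> (forall s t, t \in X -> s \subset t -> s \in X) ->
  is_complex X.
Proof.
move=> h0 h; rewrite /is_complex h0; apply/forall_inP => t tX.
by apply/forallP => s; apply/implyP; apply: h.
Qed.

Lemma complex_convex X : is_complex X -> convex X.
Proof. by move=> cX s t u _ uX _; apply: complex_sub. Qed.

Lemma convex_filter X (P : pred {set T}) :
  convex X -> (forall s t u : {set T}, P s -> P u -> s \subset t -> t \subset u -> P t) ->
  convex [set t in X | P t].
Proof.
move=> cX cP s t u; rewrite !inE => /andP[sX Ps] /andP[uX Pu] st tu.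
by rewrite (cX _ _ _ sX uX) //= (cP _ _ _ Ps Pu).
Qed.

Lemma convex_star X s u : convex X -> convex (star X s u).
Proof.
move=> cX; apply: convex_filter => // s1 t1 u1 /andP[h1 _] /andP[_ h2] h3 h4.
by rewrite (subset_trans h1) //=; apply: contra h2 => /subset_trans; apply.
Qed.

Lemma convex_box_minus p w u : convex (box_minus p w u).
Proof.
move=> s1 t1 u1; rewrite !inE => /and3P[h1 _ _] /and3P[_ h2 h3] h4 h5.
by rewrite (subset_trans h1) //= (subset_trans h5) //=; apply: contra h3 => /subset_trans; apply.
Qed.

Lemma convex_induced X A : convex X -> convex (induced X A).
Proof.
move=> cX; apply: convex_filter => // s1 t1 u1 _ h1 _ h2; exact: subset_trans h1.
Qed.

Lemma join_bdr a b t : [disjoint a & b] ->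
  (t \in join (simplex a) (bdsimplex b)) = (t \subset a :|: b) && ~~ (b \subset t).
Proof.
move=> dab; apply/imset2P/andP => [[s s']|[tw bt]].
  rewrite !inE => sa /andP[nb sb] ->; rewrite setUSS //; split=> //.
  apply: contra nb => bs; rewrite eqEsubset sb; apply/subsetP => x xb.
  move/subsetP/(_ x xb): bs; rewrite inE => /orP[/(subsetP sa)|//].
  by rewrite (disjointFl dab xb).
exists (t :&: a) (t :&: b); rewrite ?inE ?subsetIr //.
  by rewrite andbT; apply: contra bt => /eqP <-; rewrite subsetIl.
by rewrite -setIUr; apply/esym/setIidPl.
Qed.

Lemma join_bdl a b t : [disjoint a & b] ->
  (t \in join (bdsimplex a) (simplex b)) = (t \subset a :|: b) && ~~ (a \subset t).
Proof.
rewrite disjoint_sym setUC => /join_bdr <-.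
by apply/imset2P/imset2P => -[s s' h h' ->]; exists s' s => //; rewrite setUC.
Qed.

Lemma bistellar_flip a b X Y : bistellar a b X Y ->
  flip a b X Y /\ (#|a| + #|b|)%N = (dimS X).+1.
Proof.
move=> /and5P[a0 b0 dab /eqP e /andP[/eqP /setP ind /eqP ->]]; split=> //.
have hX t : t \subset a :|: b -> (t \in X) = ~~ (b \subset t).
  by move=> tw; have := ind t; rewrite inE tw andbT join_bdr // tw.
split=> // t; rewrite !inE join_bdr // join_bdl //.
case: ifP => tw /=; last by rewrite orbF.
by rewrite hX // andNb.
Qed.

Lemma dimS_max X t : t \in X -> (#|t| <= dimS X)%N.
Proof. by move=> tX; rewrite /dimS; apply: (bigop.bigmax_sup t). Qed.

Lemma dimS_ex X : is_complex X -> exists2 t, t \in X & #|t| = dimS X.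
Proof.
move=> cX; have [|t tX e] := @bigop.eq_bigmax_cond _ (mem X) (fun s : {set T} => #|s|).
  by apply/card_gt0P; exists set0; apply: complex_set0.
by exists t; rewrite // -e.
Qed.

Lemma dimS_eq X n t : (forall s, s \in X -> (#|s| <= n)%N) -> t \in X -> #|t| = n ->
  dimS X = n.
Proof.
move=> h tX tn; apply/eqP; rewrite eqn_leq -{2}tn dimS_max // andbT.
by apply/bigop.bigmax_leqP => s; apply: h.
Qed.

End Moves.

Section MoveAcyclic.

Variables (F : fieldType) (T : finType) (sg : {set T} -> T -> F).
Hypothesis sgP : incidence sg.
Implicit Types (X Y Q D U : {set {set T}}) (a b s t u p w A : {set T}) (x y z : T).

(** With [s0] empty, the homological content of being a sphere: up to a shift,
    all links have the homology of the link of a facet.  With [s0] a vertex,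
    the same for the link of that vertex. *)
Definition star_acyclic s0 X : Prop :=
  forall s u, s0 \subset s -> s \subset u -> u \in X -> acyclic sg (star X s u).

(** A point [y] of [w] outside of [p] is an apex, provided that adding it never
    completes [u]. *)
Lemma box_minus_acyclic y p w u : y \in w -> y \notin p ->
  (y \in u -> ~~ (u \subset w)) -> acyclic sg (box_minus p w u).
Proof.
move=> yw yp yu; apply: (cone_acyclic sgP (y := y)) => t yt; rewrite !inE.
rewrite subUset sub1set yw /=.
have -> : (p \subset y |: t) = (p \subset t).
  apply/idP/idP => [h|/subset_trans]; last by apply; apply: subsetUr.
  apply/subsetP => z zp; move/subsetP/(_ z zp): h; rewrite in_setU1 => /orP[/eqP e|//].
  by move: yp; rewrite -e zp.
congr (_ && _); case tw: (t \subset w) => //=; congr (~~ _).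
apply/idP/idP => [h|/subset_trans]; last by apply; apply: subsetUr.
apply/subsetP => z zu; move/subsetP/(_ z zu): (h); rewrite in_setU1 => /orP[/eqP e|//].
have := yu; rewrite -e zu => /(_ isT); rewrite (subset_trans h) //.
by rewrite subUset sub1set yw.
Qed.

Lemma star_acyclicE s u X : star_acyclic set0 X -> s \subset u -> u \in X ->
  acyclic sg (star X s u).
Proof. by move=> h; apply: h; apply: sub0set. Qed.

Lemma flip_sym a b X Y : flip a b X Y -> flip b a Y X.
Proof.
case=> a0 b0 dab hX hY; split=> //; first by rewrite disjoint_sym.
  by move=> t; rewrite setUC hY => ->.
by move=> t; rewrite setUC hY; case: ifP => [/hX|->].
Qed.

Lemma flip_card a b X Y : flip a b X Y -> #|a :|: b| = (#|a| + #|b|)%N.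
Proof. by case=> _ _ dab _ _; apply/eqP; rewrite (leq_card_setU a b). Qed.

Lemma star_fill_cut a b X Y s u : flip a b X Y -> is_complex X ->
  cut (star (X :|: powerset (a :|: b)) s u) (star X s u) (box_minus (s :|: b) (a :|: b) u).
Proof.
move=> [a0 b0 dab hX hY] cX; split.
- apply: convex_star => s1 t1 u1 _; rewrite !inE => /orP[uX|uw] _ tu.
    by rewrite (complex_sub cX uX tu).
  by rewrite (subset_trans tu uw) orbT.
- apply/setP => t; rewrite !inE subUset; case tw: (t \subset a :|: b); last first.
    by rewrite /= andbF !orbF.
  by rewrite orbT hX //; case: (b \subset t); case: (s \subset t); case: (u \subset t).
move=> t t'; rewrite !inE subUset => /and3P[/andP[_ bt] tw _] /andP[tX _].
by apply: contraL bt => tt'; rewrite -hX // (complex_sub cX tX).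
Qed.

Lemma star_fill a b X Y s u : flip a b X Y -> is_complex X ->
  acyclic sg (box_minus (s :|: b) (a :|: b) u) ->
  acyclic sg (star X s u) <-> acyclic sg (star (X :|: powerset (a :|: b)) s u).
Proof.
move=> m cX iA; have h := star_fill_cut s u m cX; split=> hA.
  exact (acyclic_cut sgP h hA iA).
exact (acyclic_lower sgP h hA iA).
Qed.

(** The closure property that a bistellar move needs: the faces of [X] above
    [a] are among those that it removes.  The faces above [a] strictly inside
    [a :|: b] carry a top cycle, the boundary of [a :|: b].  If [t] above [a]
    were not inside, this cycle would lie in the star of [a] minus the star of
    [t], an acyclic family without cells to bound it. *)
Lemma flip_star a b X Y t : flip a b X Y -> is_complex X ->
  (#|a| + #|b|)%N = (dimS X).+1 -> star_acyclic set0 X ->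
  t \in X -> a \subset t -> t \subset a :|: b.
Proof.
move=> m cX hN hA tX at_; have wN := flip_card m; have [a0 b0 dab hX hY] := m.
set w := a :|: b in wN *; apply: contraT => tw.
(* J is the part of the boundary of w above a, and R the rest of the star. *)
pose J := box_minus a w w; pose R := [set r in star X a t | ~~ (r \subset w)].
have c1 : cut (star X a t) J R.
  split; first exact/convex_star/complex_convex.
    apply/setP => r; rewrite !inE; case rw: (r \subset w); last first.
      by case: (r \in X); case: (a \subset r); case: (t \subset r).
    rewrite andbF orbF hX //=; case ar: (a \subset r); rewrite ?andbF //=.
    have -> : (t \subset r) = false.
      by apply: contraNF tw => /subset_trans; apply.
    by rewrite andbT subUset ar.
  move=> r r'; rewrite !inE => /andP[_ rw] /and3P[_ rw' _].
  by apply: contra rw => /subset_trans; apply.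
have c2 : cut (box_minus a w (w :|: t)) J [set w].
  split; first exact: convex_box_minus.
    apply/setP => r; rewrite !inE; case rw: (r \subset w); last first.
      by rewrite !andbF /=; apply/esym/negbTE; apply: contraFN rw => /eqP->.
    rewrite subUset [t \subset r](_ : _ = false) ?andbF ?andbT //; last first.
      by apply: contraNF tw => /subset_trans; apply.
    rewrite eqEsubset rw /=; case wr: (w \subset r); rewrite ?orbT ?orbF ?andbT //.
    by rewrite (subset_trans _ wr) // subsetUl.
  move=> r r'; rewrite !inE => /eqP-> /and3P[_ _ h]; exact: h.
have [y yb] := set0Pn _ b0.
have aw : acyclic sg (box_minus a w (w :|: t)).
  apply: (@box_minus_acyclic y); first by rewrite inE yb orbT.
    by rewrite (disjointFl dab yb).
  by move=> _; rewrite subUset negb_and tw orbT.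
have vJ : vanishes sg (dimS X) J.
  apply: (vanishes_lower sgP c1); first exact: star_acyclicE.
  apply: vanishes_nocells => r; rewrite !inE => /andP[/andP[rX _] _] rN.
  by have := dimS_max rX; rewrite rN ltnn.
have := not_vanishes_single (sg := sg) (t := w); rewrite wN hN; case.
exact (vanishes_upper sgP c2 (aw _) vJ).
Qed.

Lemma flip_complex a b X Y : flip a b X Y -> is_complex X ->
  (#|a| + #|b|)%N = (dimS X).+1 -> star_acyclic set0 X -> is_complex Y.
Proof.
move=> m cX hN hA; have K t := flip_star m cX hN hA (t := t).
have [a0 b0 dab hX hY] := m; apply: complexI => [|s t].
  by rewrite hY sub0set subset0.
rewrite !hY; case: ifP => tw h st; case: ifP => sw.
- by apply: contra h => /subset_trans; apply.
- by rewrite (subset_trans st tw) in sw.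
- by apply/negP => as_; rewrite K ?(subset_trans as_ st) in tw.
- exact: complex_sub h st.
Qed.

Lemma card_setD1 w y : y \in w -> #|w| = #|w :\ y|.+1.
Proof. by move=> yw; rewrite (cardsD1 y w) yw. Qed.

Lemma flip_dimS a b X Y : flip a b X Y ->
  (#|a| + #|b|)%N = (dimS X).+1 -> dimS Y = dimS X.
Proof.
move=> m hN; have wN := flip_card m; have [a0 b0 dab hX hY] := m.
have [y ya] := set0Pn _ a0.
have yw : y \in a :|: b by rewrite inE ya.
apply: (@dimS_eq _ _ _ ((a :|: b) :\ y)).
- move=> s; rewrite hY; case: ifP => [sw as_|_]; last exact: dimS_max.
  rewrite -ltnS -hN -wN; apply: proper_card; rewrite properEneq sw andbT.
  by apply: contraNneq as_ => ->; rewrite subsetUl.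
- rewrite hY subD1set; apply/subsetPn; exists y => //.
  by rewrite !inE eqxx.
- by apply/eqP; rewrite -eqSS -card_setD1 // wN hN.
Qed.

(** For a face [u] of both complexes, [star X s u] and [star Y s u] differ from
    their common filling by boxes, which are cones.  The new faces [u] are
    those above [b].  If also [s] is above [b], the star is itself a box.
    Otherwise [u] is enlarged to the facet [f] of [Y], and [star Y s f] is
    compared with [star X s g] for the facet [g] of [X]: both are their common
    part [R] plus a box. *)
Lemma flip_star_acyclic a b X Y : flip a b X Y -> is_complex X ->
  (#|a| + #|b|)%N = (dimS X).+1 -> star_acyclic set0 X -> star_acyclic set0 Y.
Proof.
move=> m cX hN hA s u _ su uY.
have cY := flip_complex m cX hN hA.
have K t := flip_star m cX hN hA (t := t).
have [a0 b0 dab hX hY] := m; have m' := flip_sym m.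
have sY := complex_sub cY uY su.
have [uX|uX] := boolP (u \in X).
  have sX := complex_sub cX uX su.
  have e : b :|: a = a :|: b by rewrite setUC.
  (* Each of the two boxes is a cone over a vertex of a, resp. b, that lies
     outside of s, and outside of u when u is inside a :|: b. *)
  have pt (c d : {set T}) (Z : {set {set T}}) : s \in Z -> u \in Z -> [disjoint c & d] ->
      c :|: d = a :|: b ->
      (forall t, t \in Z -> t \subset a :|: b -> ~~ (c \subset t)) ->
      acyclic sg (box_minus (s :|: d) (a :|: b) u).
    move=> sZ uZ dcd cd hZ; have [sw|sw] := boolP (s \subset a :|: b); last first.
      have -> : box_minus (s :|: d) (a :|: b) u = set0.
        apply/setP => t; rewrite !inE; apply/negbTE; apply: contra sw.
        by rewrite subUset => /and3P[/andP[st _] tw _]; apply: subset_trans st tw.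
      by move=> n; apply: vanishes_nocells => t; rewrite inE.
    have [y [yc ys yu]] : exists y, [/\ y \in c, y \notin s & y \in u -> ~~ (u \subset a :|: b)].
      have [uw|uw] := boolP (u \subset a :|: b); last first.
        by have /subsetPn[y yc ys] := hZ _ sZ sw; exists y.
      have /subsetPn[y yc yu] := hZ _ uZ uw; exists y; split=> //.
        by apply: contra yu; apply: (subsetP su).
      by rewrite (negPf yu).
    apply: (@box_minus_acyclic y) => //; first by rewrite -cd inE yc.
    by rewrite inE (negPf ys) (disjointFr dcd yc).
  have i1 : acyclic sg (box_minus (s :|: b) (a :|: b) u).
    by apply: (pt a b Y) => // t; rewrite hY => tY tw; rewrite tw in tY.
  have i2 : acyclic sg (box_minus (s :|: a) (b :|: a) u).
    rewrite e; apply: (pt b a X) => //; first by rewrite disjoint_sym.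
    by move=> t tX tw; rewrite -hX.
  apply/(star_fill m' cY i2); rewrite e.
  have -> : Y :|: powerset (a :|: b) = X :|: powerset (a :|: b).
    by apply/setP => t; rewrite !inE hY; case: ifP; rewrite ?orbT ?orbF.
  by apply/(star_fill m cX i1); apply: star_acyclicE.
have [uw bu au] : [/\ u \subset a :|: b, b \subset u & ~~ (a \subset u)].
  move: uY uX; rewrite hY; case: ifP => [uw -> |_ ->] //.
  by rewrite hX // negbK.
have bX t : b \subset t -> t \notin X.
  move=> bt; apply/negP => /complex_sub/(_ bt).
  by rewrite hX ?subsetUr // subxx => /(_ cX).
have [y ya yu] := subsetPn au.
have yw : y \in a :|: b by rewrite inE ya.
(* A face of Y above b is inside a :|: b, so the star of p in Y is a box there. *)
have case1 (p q : {set T}) : b \subset p -> p \subset q -> q \subset a :|: b -> y \notin q ->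
    acyclic sg (star Y p q).
  move=> bp pq qw yq; have -> : star Y p q = box_minus p (a :|: b) q.
    apply/setP => t; rewrite !inE hY; case pt: (p \subset t); rewrite ?andbF //=.
    case: ifP => tw /=; last first.
      by rewrite (negPf (bX _ (subset_trans bp pt))).
    case qt: (q \subset t); rewrite ?andbF // !andbT.
    apply/negP => at_; move/negP: qt; apply; apply: subset_trans qw _.
    by rewrite subUset at_ (subset_trans bp pt).
  apply: (@box_minus_acyclic y) => //; last by rewrite (negPf yq).
  by apply: contra yq; apply: (subsetP pq).
have [bs|bs] := boolP (b \subset s); first exact: case1.
have [z zb zs] := subsetPn bs.
have zw : z \in a :|: b by rewrite inE zb orbT.
pose f := (a :|: b) :\ y; pose g := (a :|: b) :\ z.
have uf : u \subset f by rewrite subsetD1 uw.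
have fw : f \subset a :|: b by rewrite subD1set.
have yf : y \notin f by rewrite !inE eqxx.
have zg : z \notin g by rewrite !inE eqxx.
have bf : b \subset f := subset_trans bu uf.
have sw := subset_trans su uw.
have ys : y \notin s by apply: contra yu; apply: (subsetP su).
have ag : a \subset g.
  by rewrite subsetD1 subsetUl (disjointFl dab zb).
have sg_ : s \subset g by rewrite subsetD1 sw.
have gw : g \subset a :|: b by rewrite subD1set.
have gX : g \in X by rewrite hX //; apply/subsetPn; exists z.
suff Yf : acyclic sg (star Y s f).
  have h : cut (star Y s f) (star Y s u) (star Y u f).
    split; first exact/convex_star/complex_convex.
      apply/setP => t; rewrite !inE; case: (t \in Y) => //=.
      case ut: (u \subset t) => /=.
        by rewrite (subset_trans su ut) andbF /=.
      have -> : (f \subset t) = false by apply: contraFF ut; apply: subset_trans uf.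
      by rewrite orbF.
    move=> t t'; rewrite !inE => /and3P[_ ut _] /and3P[_ _ ut'].
    by apply: contra ut'; apply: subset_trans ut.
  exact (acyclic_lower sgP h Yf (case1 u f bu uf fw yf)).
pose R := [set t in X :&: Y | s \subset t].
have hXR : cut (star X s g) R (box_minus (a :|: s) (a :|: b) g).
  split; first exact/convex_star/complex_convex.
    apply/setP => t; rewrite !inE hY; case tw: (t \subset a :|: b).
      rewrite hX // subUset; case bt: (b \subset t) => /=.
        apply/esym/negbTE; rewrite negb_and negbK orbC.
        case at_: (a \subset t); rewrite /= ?orbT //.
        by rewrite (subset_trans gw) // subUset at_ bt.
      case at_: (a \subset t) => //=.
      have -> : (g \subset t) = false by apply: contraFF at_; apply: subset_trans ag.
      by rewrite orbF !andbT.
    case tX: (t \in X); rewrite ?andbF //=.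
    have -> : (g \subset t) = false.
      by apply: contraFF tw => gt; apply: K => //; apply: subset_trans gt.
    by case: (s \subset t); rewrite /= ?andbF ?andbT ?orbF.
  move=> t t'; rewrite !inE subUset hY => /and3P[/andP[at_ _] tw _] /andP[/andP[t'X t'Y] _].
  apply/negP => tt'; have at' := subset_trans at_ tt'.
  by move: t'Y; rewrite (K _ t'X at') at'.
have hYR : cut (star Y s f) R (box_minus (b :|: s) (a :|: b) f).
  split; first exact/convex_star/complex_convex.
    apply/setP => t; rewrite !inE hY; case tw: (t \subset a :|: b).
      rewrite hX // subUset; case at_: (a \subset t) => /=.
        rewrite andbF /=; apply/esym/negbTE; rewrite negb_and negbK orbC.
        case bt: (b \subset t); rewrite /= ?orbT //.
        by rewrite (subset_trans fw) // subUset at_ bt.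
      rewrite andbT; case bt: (b \subset t) => //=.
      have -> : (f \subset t) = false by apply: contraFF bt; apply: subset_trans bf.
      by rewrite orbF !andbT.
    case tX: (t \in X); rewrite ?andbF //=.
    have -> : (f \subset t) = false.
      by apply: contraTF tX => ft; apply: bX; apply: subset_trans ft.
    by case: (s \subset t); rewrite /= ?andbF ?andbT ?orbF.
  move=> t t'; rewrite !inE subUset => /and3P[/andP[bt _] tw _] /andP[/andP[t'X t'Y] _].
  by apply: contraL t'X => tt'; apply: bX; apply: subset_trans tt'.
have RA : acyclic sg R.
  apply: (acyclic_lower sgP hXR); first exact: star_acyclicE.
  apply: (@box_minus_acyclic z) => //; last by rewrite (negPf zg).
  by rewrite inE (disjointFl dab zb) (negPf zs).
apply: (acyclic_cut sgP hYR RA).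
apply: (@box_minus_acyclic y) => //; last by rewrite (negPf yf).
by rewrite inE (disjointFr dab ya) (negPf ys).
Qed.

Lemma bdsimplex_complex (c : {set T}) : c != set0 -> is_complex (bdsimplex c).
Proof.
move=> c0; apply: complexI => [|s t]; rewrite !inE.
  by rewrite eq_sym c0 sub0set.
move=> /andP[tc sc] st; rewrite (subset_trans st sc) andbT.
by apply: contra tc => /eqP e; rewrite eqEsubset sc -e.
Qed.

Lemma bdsimplex_star_acyclic (c : {set T}) : star_acyclic set0 (bdsimplex c).
Proof.
move=> s u _ su; rewrite !inE => /andP[uc sc].
have /subsetPn[y yc yu] : ~~ (c \subset u).
  by apply: contra uc => cu; rewrite eqEsubset sc.
have -> : star (bdsimplex c) s u = box_minus s c u.
  apply/setP => t; rewrite !inE.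
  case tc: (t \subset c); rewrite ?andbF //= andbT.
  case st: (s \subset t); rewrite ?andbF //=.
  have [-> | //] := eqVneq t c; by rewrite sc.
apply: (@box_minus_acyclic y) => //; last by rewrite (negPf yu).
by apply: contra yu; apply: (subsetP su).
Qed.

Lemma bdsimplex_dimS (c : {set T}) m : #|c| = m.+1 -> dimS (bdsimplex c) = m.
Proof.
move=> cm; have /card_gt0P[y yc] : (0 < #|c|)%N by rewrite cm.
apply: (@dimS_eq _ _ _ (c :\ y)).
- move=> s; rewrite !inE => /andP[sc sc']; rewrite -ltnS -cm.
  by apply: proper_card; rewrite properEneq sc.
- rewrite !inE subD1set andbT; apply/eqP => /setP/(_ y); rewrite !inE eqxx yc //.
- by apply/eqP; rewrite -eqSS -card_setD1 // cm.
Qed.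

End MoveAcyclic.

(** * Vanishing theorems for induced subcomplexes *)

Section Vanishing.

Variables (F : fieldType) (T : finType) (sg : {set T} -> T -> F).
Hypothesis sgP : incidence sg.
Implicit Types (X Y Q D U : {set {set T}}) (a b s t u p w A P W : {set T}) (x y z : T).

Definition star_in X s A : {set {set T}} :=
  [set t in X | (s \subset t) && (t \subset s :|: A)].

Lemma convex_star_in X s A : convex X -> convex (star_in X s A).
Proof.
move=> cX; apply: convex_filter => // s1 t1 u1 /andP[h1 _] /andP[_ h2] h3 h4.
by rewrite (subset_trans h1) //= (subset_trans h4).
Qed.

(** A [K]-neighbourly sphere with all faces of at most [N] points: the part of
    the star of [s] on [s :|: A] has no homology in high degrees, as long as
    some vertex [x0] is left out.  Points [y] are added to [A] while keeping
    [x0] out; what each one adds is the star of [y |: s], for which the bound is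
    one worse, and this is just what the long exact sequence tolerates.  When
    [x0] is the only point left out, the family is the star of [s] minus that
    of [x0 |: s], which is acyclic. *)
Lemma neighbourly_vanishes s0 X K N P :
  is_complex X -> star_acyclic sg s0 X ->
  (forall t, t \in X -> (#|t| <= N)%N) -> (forall t, t \in X -> t \subset P) ->
  (forall r : {set T}, r \subset P -> (#|r| <= K)%N -> r \in X) ->
  forall s A x0 n, s0 \subset s -> s \subset P -> x0 \in P -> x0 \notin s :|: A ->
  (N.+1 + #|s| <= n + K)%N -> vanishes sg n (star_in X s A).
Proof.
move=> cX hX hN hP hK s A x0 n; have cvX := complex_convex cX.
move: {2}_.+1 (ltnSn #|P :\: (s :|: A)|) => m.
elim: m s A n => // m IH s A n hm s0s sP x0P x0s hn.
have [hs|hs] := leqP K #|s|.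
  apply: vanishes_nocells => t; rewrite inE => /andP[tX _] tn.
  by have := hN _ tX; lia.
have x0ns : x0 \notin s by apply: contra x0s; rewrite inE => ->.
case: (pickP [pred y | [&& y \in P, y != x0 & y \notin s :|: A]]) => [y /and3P[yP yx ys]|no].
  have eB1 : s :|: (y |: A) = y |: (s :|: A) by rewrite setUCA.
  have eB2 : (y |: s) :|: A = y |: (s :|: A) by rewrite setUA.
  have cA : (#|P :\: (y |: (s :|: A))| < #|P :\: (s :|: A)|)%N.
    apply: proper_card; rewrite properE setDS ?subsetU1 ?subsetUr //=.
    by apply/subsetPn; exists y; [rewrite inE ys | rewrite in_setD setU11].
  have yns : y \notin s by apply: contra ys; rewrite inE => ->.
  have x0B : x0 \notin y |: (s :|: A) by rewrite in_setU1 negb_or eq_sym yx.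
  have ct : cut (star_in X s (y |: A)) (star_in X s A) (star_in X (y |: s) A).
    split; first exact: convex_star_in.
      apply/setP => t; rewrite in_setU !in_set eB1 eB2; case: (t \in X) => //=.
      rewrite subUset sub1set; case st: (s \subset t); rewrite ?andbF //= andbT.
      apply/idP/orP => [h|[/subset_trans|/andP[_]//]]; last first.
        by apply; apply: subsetUr.
      case yt: (y \in t); [by right|left]; apply/subsetP => z zt.
      move/subsetP/(_ z zt): h; rewrite in_setU1; case: eqP zt => [->|//].
      by rewrite yt.
    move=> t t'; rewrite !in_set subUset sub1set => /andP[_ /andP[/andP[yt _] _]] /and3P[_ _ h].
    by apply: contra ys => /subsetP/(_ y yt)/(subsetP h).
  apply: (vanishes_lower sgP ct).
    by apply: IH; rewrite ?eB1 // -ltnS (leq_trans _ hm).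
  apply: IH; rewrite ?eB2 //.
  - by rewrite -ltnS (leq_trans _ hm).
  - by rewrite (subset_trans s0s) // subsetUr.
  - by rewrite subUset sub1set yP.
  - by rewrite cardsU1 yns; lia.
have sX : s \in X by apply: hK => //; apply: ltnW.
have -> : star_in X s A = star X s (x0 |: s).
  apply/setP => t; rewrite !in_set; case tX: (t \in X) => //=.
  case st: (s \subset t) => //=; rewrite subUset sub1set st andbT.
  apply/idP/idP => [h|x0t]; first by apply: contra x0s; apply: (subsetP h).
  apply/subsetP => z zt; have zP : z \in P by apply: (subsetP (hP _ tX)).
  have := no z; rewrite /= zP /=; case: eqP zt => [->|_ _ /= /negbFE //].
  by rewrite (negPf x0t).
apply: hX => //; first exact: subsetUr.
apply: hK; first by rewrite subUset sub1set x0P.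
by rewrite cardsU1 x0ns.
Qed.

Lemma full_acyclic y A : y \in A -> acyclic sg (powerset A).
Proof.
move=> yA; apply: (cone_acyclic sgP (y := y)) => t _.
by rewrite !inE subUset sub1set yA.
Qed.

(** In degree [n] the complex cannot be told from the full simplex on [W]. *)
Lemma skeleton_vanishes X W n : (0 < n)%N ->
  (forall r : {set T}, r \subset W -> (#|r| <= n.+1)%N -> r \in X) ->
  vanishes sg n (induced X W).
Proof.
move=> n0 h; have [->|/set0Pn[y yW]] := eqVneq W set0.
  apply: vanishes_nocells => t; rewrite !inE => /andP[_]; rewrite subset0 => /eqP->.
  by rewrite cards0; lia.
apply: (@vanishes_eq _ _ _ n (powerset W)); last exact: full_acyclic yW n.
move=> t _ tn; rewrite !inE; case tW: (t \subset W); rewrite ?andbF //.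
by rewrite h.
Qed.

Lemma stellated_ind k (c : {set T}) (Pr : {set {set T}} -> Prop) :
  Pr (bdsimplex c) ->
  (forall a b X Y, Pr X -> flip a b X Y -> (#|a| + #|b|)%N = (dimS X).+1 ->
     (#|b| <= k)%N -> Pr Y) ->
  forall X, connect (@bistellar_lt T k) (bdsimplex c) X -> Pr X.
Proof.
move=> h0 hS X /connectP[p]; move: (bdsimplex c) h0.
elim: p => [|Y p IH] Z hZ /=; first by move=> _ ->.
case/andP => /existsP[a /existsP[b /andP[/bistellar_flip[m hN] hk]]].
apply: IH; apply: (hS a b Z) => //; case: m => _ b0 _ _ _.
by move: b0 hk; rewrite -card_gt0; lia.
Qed.

(** The facets have [m] points, so the dimension is [m] - 1. *)
Definition sphere m X : Prop :=
  [/\ is_complex X, dimS X = m & star_acyclic sg set0 X].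

Lemma sphere_bdsimplex m (c : {set T}) : #|c| = m.+1 -> sphere m (bdsimplex c).
Proof.
move=> cm; split; last exact: bdsimplex_star_acyclic.
  by apply: bdsimplex_complex; rewrite -card_gt0 cm.
exact: bdsimplex_dimS.
Qed.

Lemma sphere_flip m a b X Y : sphere m X -> flip a b X Y -> (#|a| + #|b|)%N = m.+1 ->
  sphere m Y.
Proof.
move=> [cX dX gX] mv; rewrite -dX => hN; split.
- exact: flip_complex mv cX hN gX.
- exact: flip_dimS mv hN.
- exact: flip_star_acyclic mv cX hN gX.
Qed.

Lemma stellated_sphere_ind k m (c : {set T}) (Pr : {set {set T}} -> Prop) :
  #|c| = m.+1 -> Pr (bdsimplex c) ->
  (forall a b X Y, Pr X -> sphere m X -> sphere m Y -> flip a b X Y ->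
     (#|a| + #|b|)%N = m.+1 -> (#|b| <= k)%N -> Pr Y) ->
  forall X, connect (@bistellar_lt T k) (bdsimplex c) X -> sphere m X /\ Pr X.
Proof.
move=> cm h0 hS; apply: stellated_ind; first by split=> //; apply: sphere_bdsimplex.
move=> a b X Y [sX PX] mv; have [_ -> _] := sX => hN hk.
by have sY := sphere_flip sX mv hN; split=> //; apply: hS mv hN hk.
Qed.

Definition box p w : {set {set T}} := [set t : {set T} | (p \subset t) && (t \subset w)].

(** A box with more than one face is a cone, and a box with one face has
    homology only in its own degree. *)
Lemma box_vanishes n p w : #|p| <> n -> vanishes sg n (box p w).
Proof.
move=> pn; have [wp|/subsetPn[y yw yp]] := boolP (w \subset p).
  apply: vanishes_nocells => t; rewrite inE => /andP[pt tw].
  by have -> : t = p by apply/eqP; rewrite eqEsubset pt (subset_trans tw).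
move: n {pn}; apply: (cone_acyclic sgP (y := y)) => t yt.
rewrite !inE subUset sub1set yw /=; congr (_ && _).
apply/idP/idP => [h|/subset_trans]; last by apply; apply: subsetUr.
apply/subsetP => z zp; move/subsetP/(_ z zp): h; rewrite in_setU1 => /orP[/eqP e|//].
by move: yp; rewrite -e zp.
Qed.

Lemma complexU X Y : is_complex X -> is_complex Y -> is_complex (X :|: Y).
Proof.
move=> cX cY; apply: complexI => [|s t]; first by rewrite inE complex_set0.
by rewrite !inE => /orP[] h /(complex_sub _ h) ->; rewrite ?orbT.
Qed.

Lemma powerset_complex w : is_complex (powerset w).
Proof.
apply: complexI => [|s t]; rewrite !inE ?sub0set // => tw st.
exact: subset_trans st tw.
Qed.

Lemma induced_cut b w X A : is_complex X ->
  (forall t, t \subset w -> (t \in X) = ~~ (b \subset t)) ->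
  cut (induced (X :|: powerset w) A) (induced X A) (box b (w :&: A)).
Proof.
move=> cX hX; split.
- by apply/convex_induced/complex_convex/complexU => //; apply: powerset_complex.
- apply/setP => t; rewrite !inE subsetI; case: (t \subset A); rewrite ?andbF //= !andbT.
  by case tw: (t \subset w); rewrite ?andbF // hX // andbT orbT orNb.
move=> t t'; rewrite !inE subsetI => /and3P[bt tw _] /andP[t'X _].
by apply: contraL bt => tt'; rewrite -hX // (complex_sub cX t'X).
Qed.

(** Under a move, an induced subcomplex passes to the filled complex by adding
    a box with least face [b], and from there to the result by removing a box
    with least face [a].  The first can affect homology only near degree
    [#|b|], at most [k], and the second only near [#|a|], which is at least
    [m.+1 - k]. *)
Lemma middle_vanishes k m (c : {set T}) X A n : #|c| = m.+1 ->
  connect (@bistellar_lt T k) (bdsimplex c) X ->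
  (k < n)%N -> (n + k < m)%N -> vanishes sg n (induced X A).
Proof.
move=> cm hc kn nm; suff [_ /(_ A)//] : sphere m X /\ forall B, vanishes sg n (induced X B).
pose Pr Z := forall B, vanishes sg n (induced Z B).
apply: (stellated_sphere_ind (Pr := Pr) cm _ _ hc) => [B|a b Z Y IH [cX dX _] [cY _ _] mv hN hk B].
  have cb : is_complex (bdsimplex c) by apply: bdsimplex_complex; rewrite -card_gt0 cm.
  have hb t : t \subset c -> (t \in bdsimplex c) = ~~ (c \subset t).
    by move=> tc; rewrite !inE eqEsubset tc /= andbT.
  apply: (vanishes_lower sgP (induced_cut B cb hb)); last by apply: box_vanishes; lia.
  have -> : induced (bdsimplex c :|: powerset c) B = box set0 (c :&: B).
    apply/setP => t; rewrite !inE sub0set subsetI.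
    by case: (t \subset c); rewrite ?andbF ?orbT.
  by apply: box_vanishes; rewrite cards0; lia.
have [_ _ _ hX hY] := mv; have [_ _ _ hY' _] := flip_sym mv.
have eZ : Z :|: powerset (a :|: b) = Y :|: powerset (b :|: a).
  by apply/setP => t; rewrite !inE hY (setUC b); case: ifP; rewrite ?orbT ?orbF.
apply: (vanishes_lower sgP (induced_cut B cY hY')); last by apply: box_vanishes; lia.
rewrite -eZ; apply: (vanishes_cut sgP (induced_cut B cX hX)) => //.
by apply: box_vanishes; lia.
Qed.

End Vanishing.

(** * Ranks of boundary maps *)

Section Ranks.

Variables (F : fieldType) (T : finType) (sg : {set T} -> T -> F).
Hypothesis sgP : incidence sg.
Implicit Types (Q D U : {set {set T}}) (s t : {set T}).

Local Notation chain := {ffun {set T} -> F^o}.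
Local Notation rbd := (rbd sg).
Local Notation rk := (rk sg).
Local Notation span := (span_cells F).

Lemma mem_rk_im n Q c :
  reflect (exists2 b, b \in span (cells n Q) & c = rbd Q b)
          (c \in (linfun (rbd Q) @: span (cells n Q))%VS).
Proof.
apply: (iffP memv_imgP) => -[b bn ->]; exists b => //; by rewrite lfunE.
Qed.

(** Exactness says that the kernel of one boundary map is the image of the next;
    as the image is always contained in the kernel, comparing dimensions is
    enough. *)
Lemma vanishes_card n Q : convex Q ->
  vanishes sg n Q <-> #|cells n Q| = (rk n Q + rk n.+1 Q)%N.
Proof.
move=> cQ; rewrite -(dim_span_cells F) /rk.
set f := linfun (rbd Q); set S := span (cells n Q); set B := (f @: span (cells n.+1 Q))%VS.
have sB : (B <= S :&: lker f)%VS.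
  apply/subvP => c /mem_rk_im[b bn ->]; rewrite memv_cap (rbd_span_n _ _ bn) /=.
  by rewrite memv_ker lfunE; apply/eqP/(rbd_rbd sgP cQ)/(span_cellsW bn).
rewrite -(limg_ker_dim f S) addnC; have := dimv_leqif_eq sB; case=> _ e; split=> [v | /eqP].
  congr (_ + _)%N; apply/eqP; rewrite eq_sym e eqEsubv sB /=.
  apply/subvP => c; rewrite memv_cap memv_ker lfunE /= => /andP[cS /eqP c0].
  by have [b bn eb] := v _ cS c0; apply/mem_rk_im; exists b.
rewrite eqn_add2l eq_sym e => /eqP eB c cn c0.
have : c \in B by rewrite eB memv_cap cn memv_ker lfunE c0 eqxx.
by case/mem_rk_im => b bn ->; exists b.
Qed.

Lemma rk0 Q : rk 0 Q = 0%N.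
Proof.
apply/eqP; rewrite dimv_eq0; apply/eqP/vspaceP => c; rewrite memv0.
apply/mem_rk_im/eqP => [[b /rbd0 h ->]|->]; first exact: h.
by exists 0; rewrite ?mem0v // linear0.
Qed.

Lemma rk_nocells n Q : cells n Q = set0 -> rk n Q = 0%N.
Proof.
move=> e; have := limg_ker_dim (linfun (rbd Q)) (span (cells n Q)).
rewrite dim_span_cells e cards0 => /eqP; rewrite addn_eq0 => /andP[_ /eqP].
by rewrite -e.
Qed.

Lemma rk_eq n Q Q' :
  (forall t, (#|t| <= n)%N -> (n <= #|t|.+1)%N -> (t \in Q) = (t \in Q')) ->
  rk n Q = rk n Q'.
Proof.
move=> h; rewrite /rk; have -> : cells n Q = cells n Q'.
  by apply/setP => t; rewrite !inE; case: eqP => [tn|]; rewrite ?andbF // h // tn.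
congr (\dim _); apply: eq_in_limg => c cn; rewrite !lfunE /=; apply/ffunP => t; rewrite !rbdE.
have [e|ne] := eqVneq (#|t|.+1) n; last by rewrite (bd_deg sg cn) // !if_same.
by rewrite h // -e // ltnW.
Qed.

(** For complexes, injectivity of the map induced on homology in dimension
    [n] - 1: a chain of [D] that bounds in [Q] is automatically a cycle. *)
Definition injects n D Q : Prop :=
  forall b, b \in span (cells n.+1 Q) -> rbd Q b \in span D ->
  exists2 b', b' \in span (cells n.+1 D) & rbd D b' = rbd Q b.

Lemma injects_trans n Q1 Q2 Q3 : Q1 \subset Q2 ->
  injects n Q1 Q2 -> injects n Q2 Q3 -> injects n Q1 Q3.
Proof.
move=> s12 i12 i23 b bn b1.
have [b2 b2n e2] := i23 b bn (span_sub b1 s12).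
by rewrite -e2 in b1 *; apply: i12.
Qed.

Lemma injects_refl n Q : injects n Q Q.
Proof. by move=> b bn _; exists b. Qed.

Section Cut.

Variables Q D U : {set {set T}}.
Hypothesis hc : cut Q D U.

Lemma injects_sub n Q1 : injects n Q1 Q -> injects n Q1 D.
Proof.
move=> h b bn b1; rewrite -(rbd_cutL sg hc (span_cellsW bn)) in b1 *.
by apply: h => //; apply: span_cells_mono (cutSL hc) bn.
Qed.

Lemma injects_step n : vanishes sg n.+1 U -> injects n D Q.
Proof.
move=> vU b bn bD.
have [||b1 b1n e1] := vU (restr U b).
- exact: restr_n bn.
- by rewrite -(restr_rbd_cut sg hc) ?(span_cellsW bn) // (restr_cutL hc).
have b1Q := span_cells_mono (cutSR hc) b1n.
have dn : b - rbd Q b1 \in span (cells n.+1 D).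
  apply: (span_cells_cutD hc); first by rewrite memvB // (rbd_span_n _ _ b1Q).
  rewrite linearB /= [restr U (restr Q _)](restr_rbd_cut sg hc (span_cellsW b1Q)).
  by rewrite (restr_id (span_cellsW b1n)) e1 subrr.
exists (b - rbd Q b1) => //.
rewrite -(rbd_cutL sg hc (span_cellsW dn)) rbdB (rbd_rbd sgP) ?subr0 //.
  by case: hc.
exact: span_cellsW b1Q.
Qed.

Lemma injects_vanishes n : vanishes sg n D -> injects n D Q.
Proof.
move=> vD b bn bD; have cn := span_cellsI (rbd_span_n sg Q bn) bD.
have [|b' b'n e'] := vD _ cn; last by exists b'.
rewrite -(rbd_cutL sg hc bD) (rbd_rbd sgP) //; first by case: hc.
exact: span_cellsW bn.
Qed.

(** The image of the boundary map of [Q] projects onto that of [U], and the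
    kernel of the projection contains the image for [D].  The two are equal
    exactly when chains of [D] that bound in [Q] bound in [D]. *)
Lemma rk_cut n : (rk n.+1 D + rk n.+1 U <= rk n.+1 Q)%N /\
  ((rk n.+1 D + rk n.+1 U)%N = rk n.+1 Q <-> injects n D Q).
Proof.
pose B E := (linfun (rbd E) @: span (cells n.+1 E))%VS.
pose W := (B Q :&: lker (linfun (@restr F T U)))%VS.
have eU : (linfun (@restr F T U) @: B Q)%VS = B U.
  apply/vspaceP => c; apply/memv_imgP/mem_rk_im => [[d /mem_rk_im[b bn ->] ->]|[b bn ->]].
    exists (restr U b); first exact: restr_n bn.
    by rewrite lfunE; apply: (restr_rbd_cut sg hc (span_cellsW bn)).
  have bQ := span_cells_mono (cutSR hc) bn.
  exists (rbd Q b); first by apply/mem_rk_im; exists b.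
  have e := restr_rbd_cut sg hc (span_cellsW bQ).
  by rewrite (restr_id (span_cellsW bn)) in e; rewrite lfunE; apply: esym.
have sW : (B D <= W)%VS.
  apply/subvP => c /mem_rk_im[b bn ->]; have bQ := span_cells_mono (cutSL hc) bn.
  rewrite memv_cap memv_ker lfunE -(rbd_cutL sg hc (span_cellsW bn)); apply/andP; split.
    by apply/mem_rk_im; exists b.
  rewrite /= [restr U _](restr_rbd_cut sg hc (span_cellsW bQ)).
  by rewrite (restr_cutL hc (span_cellsW bn)) linear0.
have eQ : rk n.+1 Q = (\dim W + rk n.+1 U)%N.
  by rewrite /rk -[X in (_ + \dim X)%N]eU limg_ker_dim.
have [le eW] := dimv_leqif_eq sW; split; first by rewrite eQ leq_add2r.
rewrite eQ; split=> [/eqP|h].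
  rewrite eqn_add2r eW => /eqP e b bn bD.
  have : rbd Q b \in B D.
    rewrite e memv_cap memv_ker lfunE /= (restr_cutL hc bD) eqxx andbT.
    by apply/mem_rk_im; exists b.
  by case/mem_rk_im => b' b'n ->; exists b'.
congr (_ + _)%N; apply/eqP; rewrite eW eqEsubv sW /=; apply/subvP => c.
rewrite memv_cap memv_ker lfunE => /andP[/mem_rk_im[b bn ->] /eqP r0].
have bD : rbd Q b \in span D.
  apply: (span_cutD hc) r0; apply: span_cellsW (rbd_span_n _ _ bn).
by have [b' b'n e'] := h _ bn bD; apply/mem_rk_im; exists b'.
Qed.

End Cut.

End Ranks.

(** * From the open star of a vertex to a model of its link *)

Section Transport.

Variables (F : fieldType) (V U : finType).
Variables (sgV : {set V} -> V -> F) (sgU : {set U} -> U -> F).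
Variables (N : {set V}) (x : V) (f : V -> U) (P : {set {set V}}).
Hypothesis xN : x \notin N.
Hypothesis fN : {in N &, injective f}.
Hypothesis PN : forall s, s \in P -> s \subset N.
Hypothesis sgE : forall (s : {set V}) y, s \subset N -> y \in N -> y \notin s ->
  sgU (f @: s) (f y) = sgV (x |: s) y.

Definition coned : {set {set V}} := [set x |: (s : {set V}) | s in P].
Local Notation Q := coned.
Local Notation Q' := (relabel f P).
Local Notation spanV := (@span_cells F V).
Local Notation spanU := (@span_cells F U).

Lemma setU1_inj (s s' : {set V}) : s \subset N -> s' \subset N -> x |: s = x |: s' -> s = s'.
Proof.
have nx (r : {set V}) : r \subset N -> x \notin r.
  by move=> rN; apply: contra xN; apply: (subsetP rN).
by move=> /nx sx /nx sx' /(congr1 (fun r => r :\ x)); rewrite !setU1K.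
Qed.

Lemma imset_injN (s s' : {set V}) : s \subset N -> s' \subset N -> f @: s = f @: s' -> s = s'.
Proof.
move=> sN sN' e; apply/eqP; rewrite eqEsubset; apply/andP.
have h (r r' : {set V}) : r \subset N -> r' \subset N -> f @: r = f @: r' -> r \subset r'.
  move=> rN rN' er; apply/subsetP => y yr.
  have : f y \in f @: r' by rewrite -er imset_f.
  by case/imsetP => z zr e'; rewrite (fN (subsetP rN _ yr) (subsetP rN' _ zr) e').
by split; apply: h.
Qed.

Lemma in_coned (s : {set V}) : s \subset N -> (x |: s \in Q) = (s \in P).
Proof.
move=> sN; apply/imsetP/idP => [[s' sP' e]|sP]; last by exists s.
by rewrite (setU1_inj sN (PN sP') e).
Qed.

Lemma in_relabel (s : {set V}) : s \subset N -> (f @: s \in Q') = (s \in P).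
Proof.
move=> sN; apply/imsetP/idP => [[s' sP' e]|sP]; last by exists s.
by rewrite (imset_injN sN (PN sP') e).
Qed.

Lemma card_relabel (s : {set V}) : s \subset N -> #|f @: s| = #|s|.
Proof.
move=> sN; apply: card_in_imset => y z ys zs; apply: fN; exact: (subsetP sN).
Qed.

Lemma card_coned (s : {set V}) : s \subset N -> #|x |: s| = #|s|.+1.
Proof.
by move=> sN; rewrite cardsU1 (contra _ xN) //; apply: (subsetP sN).
Qed.

Definition pullN (u : {set U}) : {set V} := [set y in N | f y \in u].

Lemma pullN_f (s : {set V}) : s \subset N -> pullN (f @: s) = s.
Proof.
move=> sN; apply/setP => y; rewrite inE; apply/andP/idP => [[yN /imsetP[z zs e]]|ys].
  by rewrite (fN yN (subsetP sN _ zs) e).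
by rewrite (subsetP sN) // imset_f.
Qed.

(** The chain isomorphism that sends the face [x |: s] to the face [f @: s]. *)
Definition push (c : {ffun {set V} -> F^o}) : {ffun {set U} -> F^o} :=
  [ffun u : {set U} => if u \in Q' then c (x |: pullN u) else 0].

Lemma push_linear : linear push.
Proof.
move=> a c c'; apply/ffunP => t; rewrite !ffunE.
by case: ifP => _; rewrite ?ffunE // scaler0 addr0.
Qed.

HB.instance Definition _ := GRing.isLinear.Build F _ _ _ push push_linear.

Lemma pushE c (s : {set V}) : s \in P -> push c (f @: s) = c (x |: s).
Proof. by move=> sP; rewrite ffunE in_relabel ?PN // sP pullN_f // PN. Qed.

Lemma push_rbd c : c \in spanV Q -> rbd sgU Q' (push c) = push (rbd sgV Q c).
Proof.
move=> /span_cellsP cQ; apply/ffunP => u; rewrite rbdE [RHS]ffunE.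
case: ifP => // /imsetP[s sP ->]; have sN := PN sP.
rewrite pullN_f // rbdE in_coned // sP !ffunE.
have fsN : f @: s \subset f @: N by apply: imsetS.
transitivity (\sum_(y' in f @: N) if y' \notin f @: s then
     sgU (f @: s) y' * push c (y' |: f @: s) else 0).
  rewrite -big_mkcondr [RHS](eq_bigl _ _ (fun=> andbC _ _)) [LHS](bigID (mem (f @: N))) /=.
  rewrite [X in _ + X]big1 ?addr0 // => y' /andP[_ yN'].
  rewrite ffunE; case: ifP; rewrite ?mulr0 // => /imsetP[s' sP' e].
  case/negP: yN'; have : y' \in f @: s' by rewrite -e setU11.
  by apply: (subsetP (imsetS _ (PN sP'))).
rewrite big_imset //= [RHS](bigID (mem N)) /= [X in _ + X]big1 ?addr0; last first.
  move=> y /andP[]; rewrite in_setU1 negb_or => /andP[yx _] yN.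
  rewrite cQ ?mulr0 //; apply/imsetP => -[s' sP' e]; case/negP: yN.
  have : y \in x |: s' by rewrite -e setU11.
  by rewrite in_setU1 (negPf yx); apply: (subsetP (PN sP')).
rewrite [RHS](eq_bigl (fun y => (y \in N) && (y \notin s))); last first.
  move=> y; rewrite in_setU1 negb_or; case yN: (y \in N); rewrite ?andbF ?andbT //=.
  by case: eqP => // e; move: xN; rewrite -e yN.
rewrite big_mkcondr /=; apply: eq_bigr => y yN.
have -> : (f y \in f @: s) = (y \in s).
  apply/imsetP/idP => [[z zs e]|ys]; last by exists y.
  by rewrite (fN yN (subsetP sN _ zs) e).
case: ifP => // ys; rewrite sgE //; congr (_ * _).
have yN' : y |: s \subset N by rewrite subUset sub1set yN.
rewrite -imsetU1 setUCA; have [yP|yP] := boolP (y |: s \in P); first exact: pushE.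
rewrite ffunE in_relabel // (negPf yP) cQ // in_coned //.
Qed.

Lemma push_span n : (linfun push @: spanV (cells n.+1 Q))%VS = spanU (cells n Q').
Proof.
apply/vspaceP => d; apply/memv_imgP/idP => [[c /span_cellsP cn ->]|/span_cellsP dn].
  rewrite lfunE; apply/span_cellsP => u un; rewrite ffunE; case: ifP => // uQ.
  case/imsetP: (uQ) un => s sP ->; rewrite pullN_f ?PN // => un; apply: cn.
  by apply: contra un; rewrite !inE card_coned ?card_relabel ?PN // in_coned ?in_relabel ?PN.
pose c : {ffun {set V} -> F^o} :=
  [ffun t : {set V} => if t \in Q then d (f @: (t :\ x)) else 0].
have cE s : s \in P -> c (x |: s) = d (f @: s).
  move=> sP; rewrite ffunE in_coned ?PN // sP setU1K //.
  by apply: contra xN; apply: (subsetP (PN sP)).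
exists c.
  apply/span_cellsP => t tn; have [tQ|tQ] := boolP (t \in Q); last by rewrite ffunE (negPf tQ).
  case/imsetP: tQ tn => s sP -> sn; rewrite cE //; apply: dn; apply: contra sn.
  by rewrite !inE card_coned ?card_relabel ?PN // in_coned ?in_relabel ?PN.
rewrite lfunE; apply/ffunP => u; have [uQ|uQ] := boolP (u \in Q'); last first.
  by rewrite dn ?ffunE ?(negPf uQ) //; apply: contra uQ => /cellsP[].
by case/imsetP: uQ => s sP ->; rewrite [RHS](pushE c sP) cE.
Qed.

Lemma rk_transport n : rk sgV n.+1 Q = rk sgU n Q'.
Proof.
rewrite /rk -push_span -limg_comp.
rewrite (@eq_in_limg _ _ _ _ _ (linfun push \o linfun (rbd sgV Q))%VF); last first.
  by move=> c cn; rewrite !comp_lfunE !lfunE; apply: (push_rbd (span_cellsW cn)).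
rewrite limg_comp [RHS]limg_dim_eq //; apply/eqP; rewrite -subv0; apply/subvP => c.
rewrite memv_cap memv0 memv_ker lfunE /= => /andP[/mem_rk_im[b bn ->] /eqP/ffunP c0].
apply/eqP/ffunP => t; rewrite [RHS]ffunE.
have [tQ|tQ] := boolP (t \in Q); last by rewrite rbdE (negPf tQ).
case/imsetP: tQ => s sP ->; have := c0 (f @: s); rewrite pushE // => ->.
by rewrite ffunE.
Qed.

Lemma cells_transport n : #|cells n.+1 Q| = #|cells n Q'|.
Proof.
pose R := [set s in P | #|s| == n].
have -> : cells n.+1 Q = [set x |: (s : {set V}) | s in R].
  apply/setP => t; rewrite inE; apply/andP/imsetP => [[/imsetP[s sP ->]]|[s]].
    by rewrite card_coned ?PN // eqSS => sn; exists s; rewrite // inE sP.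
  by rewrite inE => /andP[sP sn] ->; rewrite in_coned ?card_coned ?PN // sP eqSS.
have -> : cells n Q' = [set f @: (s : {set V}) | s in R].
  apply/setP => t; rewrite inE; apply/andP/imsetP => [[/imsetP[s sP ->]]|[s]].
    by rewrite card_relabel ?PN // => sn; exists s; rewrite // inE sP.
  by rewrite inE => /andP[sP sn] ->; rewrite in_relabel ?card_relabel ?PN // sP.
rewrite !card_in_imset // => s s'; rewrite !inE => /andP[/PN sN _] /andP[/PN sN' _].
  exact: imset_injN.
exact: setU1_inj.
Qed.

Lemma vanishes_transport n : incidence sgV -> incidence sgU -> convex Q -> convex Q' ->
  vanishes sgU n Q' -> vanishes sgV n.+1 Q.
Proof.
move=> iV iU cQ cQ' /(vanishes_card iU _ cQ') h; apply/(vanishes_card iV _ cQ).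
by rewrite cells_transport h !rk_transport.
Qed.

End Transport.

Section Signs.

Variables (F : fieldType) (T : finType).

(** The usual signs for the order given by [rho], twisted by a sign [eta] for
    each point.  The twist absorbs the contribution of the apex to the signs
    on its star, see [transport_sign]. *)
Definition order_sign (eta : T -> F) (rho : T -> nat) (s : {set T}) (x : T) : F :=
  eta x * (-1) ^+ #|[set y in s | (rho y < rho x)%N]|.

Lemma card_below (rho : T -> nat) (s : {set T}) x y : x \notin s ->
  #|[set z in x |: s | (rho z < rho y)%N]| =
  ((rho x < rho y) + #|[set z in s | (rho z < rho y)%N]|)%N.
Proof.
move=> xs; case h: (rho x < rho y)%N.
  rewrite (_ : [set z in x |: s | _] = x |: [set z in s | (rho z < rho y)%N]).
    by rewrite cardsU1 !inE (negPf xs).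
  by apply/setP => z; rewrite !inE; case: eqP => [->|].
rewrite add0n; apply: eq_card => z; rewrite !inE; case: eqP => //= ->.
by rewrite h andbF.
Qed.

Lemma order_sign_incidence eta rho : (forall x, eta x * eta x = 1) -> injective rho ->
  incidence (order_sign eta rho).
Proof.
move=> h rI; split=> [s x|s x y xs ys xy].
  by rewrite /order_sign mulrACA h mul1r -expr2 sqrr_sign.
rewrite /order_sign !card_below // !exprD.
have -> : (rho y < rho x)%N = ~~ (rho x < rho y)%N.
  by rewrite -leqNgt ltn_neqAle (inj_eq rI) eq_sym xy.
rewrite signrN; move: (eta x) (eta y) => e e'.
move: ((-1) ^+ _) ((-1) ^+ #|_|) ((-1) ^+ #|_|) => p q r.
by rewrite !mulNr !mulrN opprK mulrACA [RHS]mulrACA [e' * e]mulrC; congr (_ * _);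
  rewrite mulrCA [RHS]mulrCA [q * r]mulrC.
Qed.

End Signs.

Definition enum_sign (F : fieldType) (V : finType) : {set V} -> V -> F :=
  order_sign (fun=> 1) (fun x : V => enum_rank x).

Lemma enum_sign_incidence (F : fieldType) (V : finType) :
  incidence (@enum_sign F V).
Proof.
apply: order_sign_incidence => [x|x y /ord_inj /enum_rank_inj //].
by rewrite mulr1.
Qed.

(** Removing [x] from a face above it changes the sign of [y] according to
    whether [x] comes before [y]; this depends on [y] alone, so it can be taken
    as the twist.  Points outside the image of [N] are put last. *)
Lemma transport_sign (F : fieldType) (V U : finType) (N : {set V}) x (f : V -> U) :
  {in N &, injective f} ->
  exists2 sgU : {set U} -> U -> F, incidence sgU &
    forall (s : {set V}) y, s \subset N -> x \notin s -> y \in N -> y \notin s ->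
      sgU (f @: s) (f y) = enum_sign F (x |: s) y.
Proof.
move=> fN; pose g u := [pick y in N | f y == u].
have gf y : y \in N -> g (f y) = Some y.
  move=> yN; rewrite /g; case: pickP => [z /andP[zN /eqP e]|/(_ y)].
    by rewrite (fN z y zN yN e).
  by rewrite yN eqxx.
pose rho u : nat := if g u is Some y then (enum_rank y : nat) else (#|V| + enum_rank u)%N.
pose eta u : F := if g u is Some y then (-1) ^+ (enum_rank x < enum_rank y)%N else 1.
have rI : injective rho.
  move=> u u'; rewrite /rho /g; case: pickP => [y /andP[yN /eqP ey]|_].
    case: pickP => [z /andP[zN /eqP ez] e|_ e].
      by rewrite -ey -ez; congr f; apply: enum_rank_inj; apply: ord_inj.
    by have := ltn_ord (enum_rank y); rewrite e ltnNge leq_addr.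
  case: pickP => [z /andP[zN /eqP ez] e|_ e].
    by have := ltn_ord (enum_rank z); rewrite -e ltnNge leq_addr.
  by apply: enum_rank_inj; apply: ord_inj; apply: (addnI e).
exists (order_sign eta rho).
  apply: order_sign_incidence => // u; rewrite /eta; case: (g u) => [y|]; last by rewrite mulr1.
  by rewrite -expr2 sqrr_sign.
move=> s y sN xs yN ys; rewrite /enum_sign /order_sign mul1r card_below // exprD /eta gf //.
congr (_ * _ ^+ _).
have -> : [set z in f @: s | (rho z < rho (f y))%N] =
          f @: [set z in s | (enum_rank z < enum_rank y)%N].
  apply/setP => u; rewrite inE; apply/andP/imsetP => [[/imsetP[z zs ->]]|[z]].
    rewrite /rho !gf // ?(subsetP sN) // => h; exists z => //; by rewrite inE zs.
  rewrite inE => /andP[zs h] ->; split; first exact: imset_f.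
  by rewrite /rho !gf // (subsetP sN).
apply: card_in_imset => z z'; rewrite !inE => /andP[zs _] /andP[zs' _].
by apply: fN; apply: (subsetP sN).
Qed.

Section Links.

Variables (V : finType) (M : {set {set V}}) (x : V).
Implicit Types (s t u W : {set V}) (y z : V).
Hypothesis cM : is_complex M.
Local Notation L := (link M x).
Local Notation N := (vertices L).

Lemma link_sub t : t \in L -> t \subset N.
Proof.
rewrite !inE => /and3P[tM xt xtM]; apply/subsetP => y yt; rewrite !inE.
have sy : [set y] \subset t by rewrite sub1set.
rewrite (complex_sub cM tM sy) (complex_sub cM xtM (setUS _ sy)) andbT /=.
by apply: contra xt => /eqP ->.
Qed.

Lemma notin_link : x \notin N.
Proof. by rewrite !inE eqxx andbF. Qed.

Lemma sub_notin (t : {set V}) : t \subset N -> x \notin t.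
Proof. by move=> tN; apply: contra notin_link; apply: (subsetP tN). Qed.

Lemma mem_link t : x \in t -> (t :\ x \in L) = (t \in M).
Proof.
move=> xt; rewrite !inE eqxx setD1K //=; apply/andP/idP => [[]//|tM]; split=> //.
by apply: complex_sub cM tM _; rewrite subD1set.
Qed.

Lemma coned_filter (P R : pred {set V}) :
  (forall t, x \in t -> t \in M -> P t = (x \in t) && R (t :\ x)) -> (forall t, P t -> x \in t) ->
  [set t in M | P t] = coned x [set t in L | R t].
Proof.
move=> h hx; apply/setP => t; apply/idP/imsetP => [|[s]].
  case/setIdP => tM Pt; have xt := hx _ Pt; exists (t :\ x).
    by rewrite in_set mem_link // tM; have := h _ xt tM; rewrite Pt xt.
  by rewrite setD1K.
case/setIdP => sL Rs ->; have xs := sub_notin (link_sub sL).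
have xsM : x |: s \in M by move: sL; rewrite inE => /and3P[].
by rewrite in_set xsM h ?setU11 // setU1K.
Qed.

Lemma star_in_coned W : star_in M [set x] W = coned x (induced L W).
Proof.
apply: coned_filter => [t xt tM|t]; rewrite sub1set; last by case/andP.
rewrite xt /=; apply/subsetP/subsetP => h z.
  by rewrite in_setD1 => /andP[zx /h]; rewrite in_setU1 (negPf zx).
move=> zt; rewrite in_setU1; case: eqP => //= /eqP zx; apply: h.
by rewrite in_setD1 zx.
Qed.

Lemma star_coned s u : x \in s -> s \subset u ->
  star M s u = coned x (star L (s :\ x) (u :\ x)).
Proof.
move=> xs su; apply: coned_filter => [t xt tM|t].
  have xu := subsetP su _ xs.
  have h (r : {set V}) : x \in r -> (r \subset t) = (r :\ x \subset t :\ x).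
    move=> xr; rewrite -[in LHS](setD1K xr) subUset sub1set xt /=.
    by rewrite subsetD1 setD11 andbT.
  by rewrite xt /= !h.
by case/andP => /subsetP/(_ x xs).
Qed.

Variables (U : finType) (f : V -> U).
Hypothesis fN : {in N &, injective f}.

Lemma imset_subN (s t : {set V}) : s \subset N -> t \subset N ->
  (f @: s \subset f @: t) = (s \subset t).
Proof.
move=> sN tN; apply/idP/idP => [h|]; last exact: imsetS.
apply/subsetP => y ys; have /imsetP[z zt e] := subsetP h _ (imset_f f ys).
by rewrite (fN (subsetP sN _ ys) (subsetP tN _ zt) e).
Qed.

Lemma relabel_filter (P : pred {set V}) (R : pred {set U}) :
  (forall t, t \in L -> P t = R (f @: t)) ->
  relabel f [set t in L | P t] = [set t in relabel f L | R t].
Proof.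
move=> h; apply/setP => u; apply/imsetP/setIdP => [[t]|[/imsetP[t tL ->] Rt]].
  by case/setIdP => tL Pt ->; rewrite -h //; split=> //; apply: imset_f.
by exists t; rewrite // in_set tL h.
Qed.

Lemma relabel_induced W :
  relabel f (induced L W) = induced (relabel f L) (f @: (W :&: N)).
Proof.
apply: relabel_filter => t /link_sub tN.
by rewrite imset_subN ?subsetIr // subsetI tN andbT.
Qed.

Lemma relabel_star s u : s \subset N -> u \subset N ->
  relabel f (star L s u) = star (relabel f L) (f @: s) (f @: u).
Proof. by move=> sN uN; apply: relabel_filter => t /link_sub tN; rewrite !imset_subN. Qed.

End Links.

Section StellatedLinks.

Variables (F : fieldType) (V : finType) (M : {set {set V}}) (k d : nat) (x : V).
Implicit Types (s t u W : {set V}) (y z : V).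
Hypothesis cM : is_complex M.
Hypothesis hL : stellatedS k d (link M x).
Local Notation sg := (@enum_sign F V).
Local Notation L := (link M x).
Local Notation N := (vertices L).

Let sgP : incidence sg := @enum_sign_incidence F V.

(** The link up to relabelling, with signs on its new points that agree with
    those on the star of [x]. *)
Lemma link_model : exists (U : finType) (f : V -> U) (c : {set U}) (sgU : {set U} -> U -> F),
  [/\ {in N &, injective f}, #|c| = d.+1, connect (@bistellar_lt U k) (bdsimplex c) (relabel f L),
    incidence sgU &
    forall (s : {set V}) y, s \subset N -> y \in N -> y \notin s ->
      sgU (f @: s) (f y) = sg (x |: s) y].
Proof.
have [U [f [c [fN cd hc]]]] := hL.
have [sgU iU eU] := @transport_sign F V U N x f fN.
exists U, f, c, sgU; split=> // s y sN yN ys; apply: eU => //.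
exact: (@sub_notin V M x s sN).
Qed.

Lemma relabel_sphere (U : finType) (f : V -> U) (c : {set U}) (sgU : {set U} -> U -> F) :
  #|c| = d.+1 -> connect (@bistellar_lt U k) (bdsimplex c) (relabel f L) -> incidence sgU ->
  sphere sgU d (relabel f L).
Proof.
move=> cd hc iU; suff [] : sphere sgU d (relabel f L) /\ True by [].
exact: (@stellated_sphere_ind _ _ _ iU _ _ _ (fun=> True) cd I _ _ hc).
Qed.

Lemma link_star_acyclic : star_acyclic sg [set x] M.
Proof.
move=> s u; rewrite sub1set => xs su uM [|n].
  by apply: vanishes_nocells => t; rewrite inE => /and3P[_ /subsetP/(_ x xs) + _ t0];
    rewrite (cards0_eq t0) inE.
have [U [f [c [sgU [fN cd hc iU eU]]]]] := link_model.
have [cS dS gS] := relabel_sphere cd hc iU.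
have xu := subsetP su _ xs.
have uL : u :\ x \in L by rewrite mem_link.
have uN := link_sub cM uL; have sN := subset_trans (setSD _ su) uN.
rewrite (star_coned cM xs su); apply: (vanishes_transport (f := f) _ fN _ eU sgP iU).
- exact: notin_link.
- by move=> t /setIdP[/(link_sub cM)].
- rewrite -(star_coned cM xs su); exact/convex_star/complex_convex.
- by rewrite relabel_star //; apply/convex_star/complex_convex.
rewrite relabel_star //; apply: star_acyclicE => //; first exact/imsetS/setSD.
by apply/imsetP; exists (u :\ x).
Qed.

Lemma link_middle_vanishes n W : (k.+1 < n)%N -> (n + k <= d)%N ->
  vanishes sg n (star_in M [set x] W).
Proof.
case: n => // n kn nd.
have [U [f [c [sgU [fN cd hc iU eU]]]]] := link_model.
have [cS dS gS] := relabel_sphere cd hc iU.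
rewrite star_in_coned //; apply: (vanishes_transport (f := f) _ fN _ eU sgP iU).
- exact: notin_link.
- by move=> t /setIdP[/(link_sub cM)].
- rewrite -star_in_coned //; exact/convex_star_in/complex_convex.
- by rewrite relabel_induced //; apply/convex_induced/complex_convex.
rewrite relabel_induced //; exact: (middle_vanishes iU cd hc).
Qed.

Lemma link_facet : exists u, [/\ u \in M, x \in u & #|u| = d.+1].
Proof.
have [U [f [c [sgU [fN cd hc iU eU]]]]] := link_model.
have [cS dS gS] := relabel_sphere cd hc iU.
have [t /imsetP[s sL ->] ts] := dimS_ex cS.
exists (x |: s); rewrite setU11; split=> //; first by move: sL; rewrite inE => /and3P[].
have sN := link_sub cM sL.
rewrite cardsU1 (sub_notin sN) -dS -ts card_in_imset // => y z ys zs.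
by apply: fN; apply: (subsetP sN).
Qed.

End StellatedLinks.

(** * Tightness and injectivity, one vertex at a time *)

Lemma extend_ind (V : finType) (Pr : {set V} -> Prop) (W E : {set V}) : W \subset E ->
  Pr E ->
  (forall (W' : {set V}) x, x \notin W' -> x |: W' \subset E -> Pr (x |: W') -> Pr W') ->
  Pr W.
Proof.
move=> WE hE hS; move: {2}(#|E :\: W|) (leqnn #|E :\: W|) => m.
elim: m W WE => [|m IH] W WE hm.
  suff -> : W = E by [].
  apply/eqP; rewrite eqEsubset WE -setD_eq0 -cards_eq0; lia.
have [EW|/subsetPn[x xE xW]] := boolP (E \subset W).
  by suff -> : W = E by []; apply/eqP; rewrite eqEsubset WE.
apply: (hS W x xW); first by rewrite subUset sub1set xE.
apply: IH; first by rewrite subUset sub1set xE.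
rewrite -ltnS; apply: leq_trans hm; apply: proper_card.
rewrite properE setDS ?subsetUr //=; apply/subsetPn; exists x; first by rewrite inE xW.
by rewrite in_setD setU11.
Qed.

Section Tightness.

Variables (F : fieldType) (V : finType) (M : {set {set V}}).
Implicit Types (Q : {set {set V}}) (r s t u W E : {set V}) (x y z : V).
Hypothesis cM : is_complex M.
Local Notation sg := (@enum_sign F V).
Local Notation P := (vertices M).
Local Notation rbd := (rbd sg).
Local Notation span := (span_cells F).
Local Notation chain := {ffun {set V} -> F^o}.

Let sgP : incidence sg := @enum_sign_incidence F V.

Lemma faces_sub t : t \in M -> t \subset P.
Proof.
move=> tM; apply/subsetP => y yt; rewrite inE (complex_sub cM tM) //.
by rewrite sub1set.
Qed.

(** A set of fewer than [l] vertices extends to one of exactly [l], because [M]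
    has a face of at least [l] points. *)
Lemma neighbourly_faces l : (l <= dimS M)%N -> neighbourly l M ->
  forall r, r \subset P -> (#|r| <= l)%N -> r \in M.
Proof.
move=> lM nM r; move: {2}(l - #|r|)%N (erefl (l - #|r|)%N) => m.
elim: m r => [|m IH] r em rP rl.
  by apply: nM => //; lia.
have [t tM td] := dimS_ex cM.
have /subsetPn[y yP yr] : ~~ (P \subset r).
  apply/negP => /subset_leq_card; have := subset_leq_card (faces_sub tM); lia.
apply: (complex_sub cM (t := y |: r)); last exact: subsetUr.
have cr : #|y |: r| = #|r|.+1 by rewrite cardsU1 yr.
by apply: IH; rewrite ?cr ?subUset ?sub1set ?yP //; lia.
Qed.

Lemma induced_all : induced M P = M.
Proof. by apply/setP => t; rewrite inE; case tM: (t \in M) => //=; rewrite faces_sub. Qed.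

Lemma induced_vertices W : induced M W = induced M (W :&: P).
Proof.
apply/setP => t; rewrite !inE subsetI; case tM: (t \in M) => //=.
by rewrite faces_sub // andbT.
Qed.

Lemma induced_complex W : is_complex (induced M W).
Proof.
apply: complexI => [|s t]; first by rewrite inE complex_set0 // sub0set.
by rewrite !inE => /andP[tM tW] st; rewrite (complex_sub cM tM) // (subset_trans st).
Qed.

Lemma induced_sub W E : W \subset E -> induced M W \subset induced M E.
Proof.
by move=> WE; apply/subsetP => t; rewrite !inE => /andP[-> /subset_trans]; apply.
Qed.

Lemma induced_full_cut W : cut M (induced M W) [set t in M | ~~ (t \subset W)].
Proof.
split; first exact: complex_convex.
  by apply/setP => t; rewrite !inE; case: (t \in M) => //=; rewrite orbN.
move=> s t; rewrite !inE => /andP[_ sW] /andP[_ tW].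
by apply: contra sW => /subset_trans; apply.
Qed.

Lemma vertex_cut W x : x \notin W ->
  cut (induced M (x |: W)) (induced M W) (star_in M [set x] W).
Proof.
move=> xW; split; first exact/convex_induced/complex_convex.
  apply/setP => t; rewrite !inE sub1set; case: (t \in M) => //=.
  case xt: (x \in t) => /=.
    by have -> : (t \subset W) = false by apply: contraNF xW => /subsetP; apply.
  rewrite orbF; apply/idP/idP => [h|/subset_trans]; last by apply; apply: subsetUr.
  apply/subsetP => z zt; have := subsetP h _ zt; rewrite in_setU1; case: eqP zt => [->|//].
  by rewrite xt.
move=> s t; rewrite !inE sub1set => /and3P[_ xs _] /andP[_ tW].
by apply: contra xW => /subsetP st; apply: (subsetP tW); apply: st.
Qed.

Lemma injects_chain n W E : W \subset E ->
  (forall W' x, x \notin W' -> x |: W' \subset E -> vanishes sg n.+1 (star_in M [set x] W')) ->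
  injects sg n (induced M W) (induced M E).
Proof.
move=> WE h; pose Pr W' := injects sg n (induced M W') (induced M E).
apply: (extend_ind (Pr := Pr) WE); first exact: injects_refl.
move=> W' x xW xE; apply: injects_trans; first exact/induced_sub/subsetUr.
exact (injects_step sgP (vertex_cut xW) (h _ _ xW xE)).
Qed.

Lemma vanishes_chain n E : (0 < n)%N ->
  (forall W' x, x \notin W' -> x |: W' \subset E -> vanishes sg n (star_in M [set x] W')) ->
  forall W, W \subset E -> vanishes sg n (induced M W).
Proof.
move=> n0 h W; move: {2}(#|W|) (erefl #|W|) => m; elim: m W => [|m IH] W em WE.
  apply: vanishes_nocells => t; rewrite inE (cards0_eq em) => /andP[_].
  by rewrite subset0 => /eqP->; rewrite cards0; lia.
have /card_gt0P[x xW] : (0 < #|W|)%N by rewrite em.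
have nx : x \notin W :\ x by rewrite setD11.
have ct := vertex_cut nx; rewrite setD1K // in ct.
apply: (vanishes_cut sgP ct); first apply: IH.
- by move: em; rewrite (card_setD1 xW) => -[].
- exact: subset_trans (subD1set _ _) WE.
by apply: h; rewrite // setD1K.
Qed.

(** The two boundaries differ only at the empty face, which is seen by chains of
    single points alone; the chains here have faces of at least two points. *)
Lemma boundary_rbd Q n (b : chain) : is_complex Q -> b \in span (cells n.+2 Q) ->
  boundary F V b = rbd Q b.
Proof.
move=> cQ bn; rewrite lfunE /=; apply/ffunP => t; rewrite !ffunE.
have [->|t0] := eqVneq t set0.
  have := @bd_deg _ _ sg n.+2 Q b set0 bn; rewrite cards0 => /(_ isT).
  by rewrite ffunE => ->; rewrite if_same.
case: ifPn => tQ.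
  by apply: eq_bigr => x _; rewrite /enum_sign /order_sign mul1r.
rewrite big1 // => x _; move/span_cellsP: (span_cellsW bn) => ->; first exact: mulr0.
by apply: contra tQ => /(complex_sub cQ); apply; apply: subsetUr.
Qed.

Lemma chainsE j Q : chains F j Q = span (cells j.+1 Q).
Proof. by apply: eq_bigl => s; rewrite inE. Qed.

Lemma boundariesP j Q (c : chain) : is_complex Q ->
  reflect (exists2 b, b \in span (cells j.+2 Q) & c = rbd Q b) (c \in boundaries F j Q).
Proof.
move=> cQ; rewrite /boundaries chainsE.
by apply: (iffP memv_imgP) => -[b bn ->]; exists b => //; rewrite (boundary_rbd cQ bn).
Qed.

Lemma rbd_cycle j Q Q' (b : chain) : is_complex Q -> b \in span (cells j.+2 Q) ->
  rbd Q b \in span Q' -> rbd Q b \in cycles F j Q'.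
Proof.
move=> cQ bn bQ'; rewrite memv_cap chainsE (span_cellsI (rbd_span_n sg Q bn) bQ') /=.
rewrite memv_ker lfunE /=; apply/eqP/ffunP => t; rewrite !ffunE; case: eqP => // _.
have e : rbd Q b = bd sg b.
  apply/ffunP => s; rewrite rbdE; case: ifPn => // sQ; rewrite ffunE big1 // => x _.
  move/span_cellsP: (span_cellsW bn) => ->; first exact: mulr0.
  by apply: contra sQ => /(complex_sub cQ); apply; apply: subsetUr.
have : bd sg (rbd Q b) t = 0 by rewrite e bd_bd // ffunE.
rewrite ffunE => e0; rewrite -[RHS]e0.
by apply: eq_bigr => x _; rewrite /enum_sign /order_sign mul1r.
Qed.

Lemma injects_homology j W :
  injects sg j.+1 (induced M W) M <-> injective (@homology_map F V j (induced M W) M).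
Proof.
have cW := induced_complex W.
have sW : induced M W \subset M by apply/subsetP => t; rewrite inE => /andP[].
have sC i : (chains F i (induced M W) <= chains F i M)%VS.
  by rewrite !chainsE; apply/subvP => c; apply: span_cells_mono.
have sZ : (cycles F j (induced M W) <= cycles F j M)%VS := capvS (sC j) (subvv _).
split=> [h h1 h2|h b bn bW].
  have [z1 z1Z <-] := homology_class_surj h1.
  have [z2 z2Z <-] := homology_class_surj h2.
  rewrite !homology_map_class // => e; apply/homology_class_eq => //.
  have /homology_class_eq -/(_ (subvP sZ _ z1Z) (subvP sZ _ z2Z)) := e.
  case/(boundariesP _ _ cM) => b bn eb.
  have [|b' b'n e'] := h b bn.
    rewrite -eb memvB //; [move: z1Z|move: z2Z];
    by rewrite memv_cap chainsE => /andP[/span_cellsW].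
  by apply/(boundariesP _ _ cW); exists b'; rewrite ?e'.
have zW := rbd_cycle cM bn bW; have zM := subvP sZ _ zW.
have e : homology_class j (induced M W) (rbd M b) = homology_class j (induced M W) 0.
  apply: h; rewrite !homology_map_class ?mem0v //.
  apply/homology_class_eq; rewrite ?mem0v // subr0.
  by apply/(boundariesP _ _ cM); exists b.
have /homology_class_eq := e; rewrite mem0v subr0 => /(_ zW isT).
by case/(boundariesP _ _ cW) => b' b'n e'; exists b'.
Qed.

Lemma tightE : connected_complex M ->
  tight F M <-> forall W j, (j < dimS M)%N -> injects sg j.+1 (induced M W) M.
Proof.
move=> conn; split=> [[_ h] W j jM|h]; first by apply/injects_homology; apply: h.
by split=> // W j jM; apply/injects_homology; apply: h.
Qed.

End Tightness.

Section Manifold.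

Variables (F : fieldType) (V : finType) (M : {set {set V}}) (k d : nat).
Implicit Types (Q : {set {set V}}) (r s t u W E : {set V}) (x y z : V).
Hypothesis cM : is_complex M.
Hypothesis dM : dimS M = d.+1.
Local Notation sg := (@enum_sign F V).
Local Notation P := (vertices M).
Local Notation rbd := (rbd sg).
Local Notation span := (span_cells F).
Local Notation chain := {ffun {set V} -> F^o}.
Hypothesis neM : forall r, r \subset P -> (#|r| <= k.+1)%N -> r \in M.
Hypothesis stM : forall x, x \in P -> stellatedS k d (link M x).

Let sgP : incidence sg := @enum_sign_incidence F V.

(** [neighbourly_vanishes] in [M] itself: the link of [x] is a [k]-neighbourly
    sphere because [M] is ([k] + 1)-neighbourly. *)
Lemma high_vanishes x x0 W n : x \in P -> x0 \in P -> x0 \notin x |: W ->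
  (d.+2 <= n + k)%N -> vanishes sg n (star_in M [set x] W).
Proof.
move=> xP x0P x0W nk.
have hd t : t \in M -> (#|t| <= d.+1)%N by move/dimS_max; rewrite dM.
have xx : [set x] \subset P by rewrite sub1set.
have nk' : (d.+2 + #|[set x]| <= n + k.+1)%N by rewrite cards1; lia.
exact: (neighbourly_vanishes sgP cM (link_star_acyclic cM (stM xP)) hd (faces_sub cM) neM
  (subxx _) xx x0P x0W nk').
Qed.

Lemma low_injects n W : W \subset P -> (0 < n <= k)%N -> injects sg n (induced M W) M.
Proof.
move=> WP /andP[n0 nk]; apply: (injects_vanishes sgP (induced_full_cut cM W)).
by apply: (skeleton_vanishes sgP) => // r rW rn; apply: neM; [apply: subset_trans rW WP|lia].
Qed.

Lemma top_injects W : injects sg d.+1 (induced M W) M.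
Proof.
move=> b /span_cellsP bn _; exists 0; rewrite ?mem0v //.
suff -> : b = 0 by rewrite !linear0.
apply/ffunP => t; rewrite ffunE bn //; apply/negP => /cellsP[/dimS_max].
by rewrite dM => + e; rewrite e ltnn.
Qed.

Lemma middle_injects_rel n W : (n.+1 + k <= d)%N -> (k < n)%N -> W \subset P ->
  injects sg n (induced M W) M.
Proof.
move=> nd kn WP; rewrite -[X in injects sg n _ X](induced_all cM).
apply: injects_chain => // W' x _ xP; apply: (@link_middle_vanishes F V M k d) => //.
by apply: stM; apply: (subsetP xP); apply: setU11.
Qed.

Lemma middle_injects_abs n W : (n + k <= d)%N -> (k.+1 < n)%N -> W \subset P ->
  injects sg n (induced M W) M.
Proof.
move=> nd kn WP; apply: (injects_vanishes sgP (induced_full_cut cM W)).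
apply: (vanishes_chain cM (E := P)) => //; first lia.
move=> W' x _ xP; apply: (@link_middle_vanishes F V M k d) => //.
by apply: stM; apply: (subsetP xP); apply: setU11.
Qed.

(** The whole star of [x] has the homology of the cell [u], a facet. *)
Lemma star_vanishes n x : x \in P -> n != d.+1 -> vanishes sg n (star_in M [set x] (P :\ x)).
Proof.
move=> xP nd; have [u [uM xu ud]] := link_facet F cM (stM xP).
have x1u : [set x] \subset u by rewrite sub1set.
have ct : cut (star_in M [set x] (P :\ x)) (star M [set x] u) [set u].
  split; first exact/convex_star_in/complex_convex.
    apply/setP => t; rewrite !inE setD1K //; case tM: (t \in M) => /=; last first.
      by apply/esym; apply: contraFF tM => /eqP ->.
    rewrite sub1set (faces_sub cM tM) andbT; case: eqP => [->|tu].
      by rewrite xu orbT.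
    rewrite orbF; case xt: (x \in t) => //=; apply/esym/negP => ut.
    by apply: tu; apply/esym/eqP; rewrite eqEcard ut ud -dM; move: (dimS_max tM).
  by move=> s t /set1P -> /setIdP[_ /andP[_]].
apply: (vanishes_cut sgP ct).
  exact: (link_star_acyclic cM (stM xP) (subxx _) x1u uM (n := n)).
by apply: vanishes_nocells => t /set1P ->; apply/eqP; rewrite ud eq_sym.
Qed.

Hypothesis orM : orientable F d M.

Lemma fundamental_cycle : (0 < d)%N -> exists2 z : chain, z \in span (cells d.+1 M) &
  z != 0 /\ rbd M z = 0.
Proof.
move=> d0; have nz : cycles F d M != 0%VS.
  apply/eqP => Z0; move: orM; rewrite /orientable /betti /homology Z0 dimvf /=.
  suff -> : (0 :\: boundaries F d M)%VS = 0%VS by rewrite /dim /= dimv0.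
  by apply/eqP; rewrite -subv0 diffvSl.
exists (vpick (cycles F d M)).
  by have := memv_pick (cycles F d M); rewrite memv_cap chainsE => /andP[].
rewrite vpick0 nz; split=> //; have := memv_pick (cycles F d M).
rewrite memv_cap chainsE => /andP[+ +]; case: d d0 => // e _ zn.
by rewrite memv_ker (boundary_rbd cM zn) => /eqP.
Qed.

(** Let [b] be a chain of [M] whose boundary avoids [x].  On the star of [x],
    both [b] and the fundamental cycle [z] restrict to top cycles, and the
    latter is nonzero because [M] minus [x] has no top cycle.  Top cycles of
    the star are determined by their value at one facet [u], so a multiple of
    [z] can be subtracted from [b] to clear the star of [x]. *)
Lemma orient_injects x : (0 < k)%N -> (0 < d)%N -> x \in P -> injects sg d (induced M (P :\ x)) M.
Proof.
move=> k0 d0 xP b bn bD; set E := P :\ x; set D := induced M E.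
pose Q := star_in M [set x] E.
have ct : cut M D Q.
  have xE : x \notin E by rewrite setD11.
  by have := vertex_cut cM xE; rewrite /E setD1K // induced_all.
have [z zn [z0 zc]] := fundamental_cycle d0.
have vD : vanishes sg d.+1 D.
  apply: (vanishes_chain cM (E := E)) => // W y yW yE.
  have yP : y \in P by apply: (subsetP (subD1set P x)); apply: (subsetP yE); apply: setU11.
  by apply: (high_vanishes yP xP); [apply/negP => /(subsetP yE); rewrite setD11|lia].
have rcyc c : c \in span (cells d.+1 M) -> rbd M c \in span D -> rbd Q (restr Q c) = 0.
  move=> cn cD; apply: etrans (restr_cutL ct cD).
  exact: esym (restr_rbd_cut sg ct (span_cellsW cn)).
have no2 (R : {set {set V}}) (c : chain) : R \subset M -> c \in span (cells d.+2 R) -> c = 0.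
  move=> RM /span_cellsP cn; apply/ffunP => t; rewrite ffunE cn //.
  apply/negP => /cellsP[/(subsetP RM)/dimS_max]; rewrite dM => + e.
  by rewrite e ltnn.
have [u uz] : exists u, restr Q z u != 0.
  have rz : restr Q z != 0.
    apply: contraNneq z0 => r0; have zD := span_cells_cutD ct zn r0.
    have [|c cn <-] := vD z zD; first by rewrite -(rbd_cutL sg ct (span_cellsW zD)).
    by rewrite (no2 D c (cutSL ct) cn) linear0.
  apply/existsP; apply: contraNT rz; rewrite negb_exists => /forallP h.
  by apply/eqP/ffunP => u; have := h u; rewrite negbK [RHS]ffunE => /eqP.
have zr := restr_n Q zn; have br := restr_n Q bn.
have uQ : u \in cells d.+1 Q.
  by apply: contraNT uz => uQ; move/span_cellsP: zr => ->.
have [uQ' ud] := cellsP _ _ _ uQ.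
have uM : u \in M by apply: (subsetP (cutSR ct)).
have xu : [set x] \subset u by move: uQ'; rewrite inE => /and3P[].
pose l : F := restr Q b u / restr Q z u.
pose y : chain := restr Q b - l *: restr Q z.
have yn : y \in span (cells d.+1 (star M [set x] u)).
  apply/span_cellsP => t; rewrite !ffunE => tn.
  have [->|tu] := eqVneq t u.
    rewrite uQ' /GRing.scale /= /l !ffunE uQ' divfK ?subrr //.
    by move: uz; rewrite ffunE uQ'.
  case: ifPn => [tQ|_]; last by rewrite scaler0 subr0.
  have tN : t \notin cells d.+1 M.
    apply: contra tn => /cellsP[tM td]; apply/cellsP; split=> //.
    rewrite inE tM /=; move: tQ; rewrite inE => /and3P[_ -> _] /=.
    by apply: contra tu => ut; rewrite eq_sym eqEcard ut td ud leqnn.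
  by rewrite (span_cellsP _ _ bn t tN) (span_cellsP _ _ zn t tN) scaler0 subr0.
have y0 : y = 0.
  have ct2 : cut Q (star M [set x] u) [set t in Q | u \subset t].
    split; first exact/convex_star_in/complex_convex.
      apply/setP => t; rewrite !inE /E setD1K //; case tM: (t \in M) => //=.
      by rewrite (faces_sub cM tM) andbT -andb_orr orNb andbT.
    move=> s t; rewrite !inE => /andP[_ us] /and3P[_ _ ut].
    by apply: contra ut; apply: subset_trans.
  have [|c cn <-] := @link_star_acyclic F V M k d x cM (stM xP) _ u (subxx _) xu uM d.+1 y yn.
    rewrite -(rbd_cutL sg ct2 (span_cellsW yn)) /y linearB linearZ.
    rewrite [X in X - _](rcyc b bn bD) [X in _ - _ *: X](rcyc z zn) ?zc ?mem0v //.
    by rewrite scaler0 subr0.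
  rewrite (no2 _ c _ cn) ?linear0 //.
  by apply/subsetP => t; rewrite inE => /andP[].
have b'n : b - l *: z \in span (cells d.+1 D).
  apply: (span_cells_cutD ct); first by rewrite memvB // memvZ.
  by rewrite linearB linearZ.
exists (b - l *: z) => //; rewrite -(rbd_cutL sg ct (span_cellsW b'n)).
by rewrite linearB linearZ [X in _ - _ *: X]zc scaler0 subr0.
Qed.

(** Vertices are added one by one, keeping a vertex [x] out until the end; the
    star of [x] added last is complete, and then only the top degree needs
    orientability. *)
Lemma high_injects n W : W \subset P -> (0 < k)%N -> (0 < n <= d)%N -> (d < n + k)%N ->
  injects sg n (induced M W) M.
Proof.
move=> WP k0 /andP[n0 nd] nk.
have [PW|/subsetPn[x xP xW]] := boolP (P \subset W).
  have -> : W = P by apply/eqP; rewrite eqEsubset WP.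
  by rewrite induced_all //; apply: injects_refl.
have WE : W \subset P :\ x by rewrite subsetD1 WP.
have sE := induced_sub M WE.
apply: (injects_trans sE) => //.
  apply: injects_chain => // W' y yW yE.
  have yP : y \in P by apply: (subsetP (subD1set P x)); apply: (subsetP yE); apply: setU11.
  by apply: (high_vanishes yP xP); [apply/negP => /(subsetP yE); rewrite setD11|lia].
have [->|nd'] := eqVneq n d; first by apply: orient_injects => //; lia.
have xE : x \notin P :\ x by rewrite setD11.
have := vertex_cut cM xE; rewrite setD1K // induced_all // => ct.
by apply: (injects_step sgP ct); apply: star_vanishes.
Qed.

(** The degrees below [k] and those from [d] - [k] on are covered for every [d].
    There are others only if [d] is at least 2[k] + 1; when it is larger,
    the middle vanishing for links settles degree [k] through the star that is
    added, and the degrees above it through [M[W]]. *)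
Lemma all_injects j W : (j < d.+1)%N -> j <> k \/ d <> (2 * k).+1 ->
  injects sg j.+1 (induced M W) M.
Proof.
rewrite (induced_vertices cM) => jd jk; have WP := subsetIr W P.
have [->|jd'] := eqVneq j d; first exact: top_injects.
have [jk'|kj] := ltnP j k; first by apply: low_injects => //; lia.
have [dj|dj] := ltnP d (j.+1 + k).
  apply: high_injects => //; lia.
have [ejk|njk] := eqVneq j k.
  apply: middle_injects_rel => //; lia.
by apply: middle_injects_abs => //; lia.
Qed.

End Manifold.

(** * Binomial identities *)

Lemma binr_neq0 (n m : nat) : (m <= n)%N -> 'C(n, m)%:R != 0 :> rat.
Proof. by move=> mn; rewrite pnatr_eq0 -lt0n bin_gt0. Qed.

Lemma hockey_stick e j : (\sum_(i < e.+1) 'C(i + j, j) = 'C((e + j).+1, j.+1))%N.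
Proof.
elim: e => [|e IH]; first by rewrite big_ord1 add0n !binn.
by rewrite big_ord_recr /= IH addSn [RHS]binS.
Qed.

Lemma bin_trinomial m i j : (i + j <= m)%N ->
  ('C(m, i + j) * 'C(i + j, j) = 'C(m, j) * 'C(m - j, i))%N.
Proof.
move=> h; have f0 n : (0 < n`!)%N by apply: fact_gt0.
have e1 := bin_fact h.
have e2 : ('C(i + j, j) * (j`! * i`!) = (i + j)`!)%N.
  by have := bin_fact (leq_addl i j); rewrite addnK.
have e3 : ('C(m, j) * (j`! * (m - j)`!) = m`!)%N by rewrite bin_fact //; lia.
have e4 : ('C(m - j, i) * (i`! * (m - (i + j))`!) = (m - j)`!)%N.
  have -> : (m - (i + j) = m - j - i)%N by lia.
  by rewrite bin_fact //; lia.
apply/eqP; rewrite -(eqn_pmul2r (f0 j)) -(eqn_pmul2r (f0 i)) -(eqn_pmul2r (f0 (m - (i + j))%N)).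
apply/eqP; transitivity m`!; first by rewrite -e1 -e2; ring.
by rewrite -e3 -e4; ring.
Qed.

Lemma sum_upper_weights m j : (j <= m)%N ->
  \sum_(i < (m - j).+1) 'C(m - j, i)%:R / 'C(m, i + j)%:R = m.+1%:R / j.+1%:R :> rat.
Proof.
move=> jm; have nz := binr_neq0 jm.
transitivity (\sum_(i < (m - j).+1) 'C(i + j, j)%:R / 'C(m, j)%:R : rat).
  apply: eq_bigr => i _; have hi := ltn_ord i.
  have him : (i + j <= m)%N by lia.
  apply/eqP; rewrite eqr_div // ?binr_neq0 // -!natrM.
  by rewrite [X in _ == X%:R]mulnC bin_trinomial // mulnC.
rewrite -mulr_suml -natr_sum hockey_stick subnK //.
apply/eqP; rewrite eqr_div // ?pnatr_eq0 // -!natrM eqr_nat mulnC -mul_bin_diag.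
by rewrite mulnC.
Qed.

(** The integral of x^b (1 - x)^e over the unit interval, expanded. *)
Lemma alt_beta e b :
  \sum_(i < e.+1) (-1) ^+ i * 'C(e, i)%:R / (b + i).+1%:R =
  ((b + e).+1%:R * 'C(b + e, b)%:R)^-1 :> rat.
Proof.
elim: e b => [|e IH] b.
  by rewrite big_ord1 !addn0 binn expr0 !mulr1 mul1r.
have nz n : n.+1%:R != 0 :> rat by rewrite pnatr_eq0.
have -> : \sum_(i < e.+2) (-1) ^+ i * 'C(e.+1, i)%:R / (b + i).+1%:R =
   \sum_(i < e.+1) (-1) ^+ i * 'C(e, i)%:R / (b + i).+1%:R -
   \sum_(i < e.+1) (-1) ^+ i * 'C(e, i)%:R / (b.+1 + i).+1%:R :> rat.
  rewrite big_ord_recl /= expr0 bin0.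
  have -> : \sum_(i < e.+1) (-1) ^+ i * 'C(e, i)%:R / (b + i).+1%:R =
     1 / (b + 0).+1%:R +
     \sum_(i < e.+1) (-1) ^+ i.+1 * 'C(e, i.+1)%:R / (b + i.+1).+1%:R :> rat.
    rewrite big_ord_recl /= expr0 bin0 mulr1; congr (_ + _).
    by rewrite [RHS]big_ord_recr /= bin_small // mulr0 mul0r addr0; apply: eq_bigr.
  rewrite mulr1 -addrA -sumrB; congr (_ + _); apply: eq_bigr => i _.
  rewrite /bump /= add1n binS natrD addnS addSn exprS; field.
  by rewrite -!natrD; apply: nz.
rewrite !IH addnS addSn.
have h1 : ('C(b + e, b) * (b + e).+1 = 'C((b + e).+1, b.+1) * b.+1)%N.
  by rewrite mulnC mul_bin_diag mulnC.
have h2 : ('C(b + e, b) * (b + e).+1 = 'C((b + e).+1, b) * e.+1)%N.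
  have := mul_bin_down (b + e).+1 b; rewrite subSn ?leq_addr // addKn /= => h.
  by rewrite mulnC [RHS]mulnC.
have c0 : 'C(b + e, b)%:R != 0 :> rat by apply/binr_neq0/leq_addr.
have H1 : 'C((b + e).+1, b.+1)%:R = 'C(b + e, b)%:R * (b + e).+1%:R / b.+1%:R :> rat.
  by rewrite -natrM h1 natrM mulfK ?nz.
have H2 : 'C((b + e).+1, b)%:R = 'C(b + e, b)%:R * (b + e).+1%:R / e.+1%:R :> rat.
  by rewrite -natrM h2 natrM mulfK ?nz.
rewrite H1 H2; have := nz e; have := nz b; have := nz (b + e)%N; have := nz (b + e).+1.
rewrite -!natr1 !natrD => n1 n2 n3 n4; field.
by rewrite n3 n4 c0 n1 n2.
Qed.

(** The number of sets of size [j] between a set of size [b] and a set of size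
    [D] that contains it; truncated subtraction makes the test necessary. *)
Definition guarded_bin D b j : nat := if (b <= j)%N then 'C(D - b, j - b) else 0.

(** The face numbers of a neighbourly complex in terms of its h-numbers,
    which count multisets. *)
Lemma vandermonde_multiset r D j : (j <= D)%N ->
  (\sum_(b < j.+1) 'C(r + b - 1, b) * 'C(D - b, j - b) = 'C(r + D, j))%N.
Proof.
elim: r D j => [|r IHr] D j jD.
  rewrite big_ord_recl /= !subn0 mul1n big1 ?addn0 // => i _.
  by rewrite /bump /= add0n add1n subn1 /= bin_small.
elim: D j jD => [|D IHD] [|j] // jD; rewrite ?big_ord1 ?bin0 //.
rewrite big_ord_recl /= bin0 !subn0 mul1n.
rewrite (eq_bigr (fun i : 'I_j.+1 => 'C(r + i.+1 - 1, i.+1) * 'C(D.+1 - i.+1, j.+1 - i.+1) +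
   'C(r.+1 + i - 1, i) * 'C(D - i, j - i)))%N; last first.
  move=> i _; rewrite /bump /= add1n addnS !addSn !subn1 /= subSS binS mulnDl.
  by rewrite subSS addnS.
have e1 : (r.+1 + D.+1 = (r + D.+1).+1)%N by lia.
have e2 : (r.+1 + D = r + D.+1)%N by lia.
rewrite big_split /= IHD // e1 e2 [RHS]binS addnA; congr (_ + _)%N.
rewrite -(IHr D.+1 j.+1) // [RHS]big_ord_recl /= bin0 mul1n subn0.
by congr (_ + _)%N; apply: eq_bigr => i _; rewrite /bump /= add1n.
Qed.

Lemma triangular_uniq k D (g h : nat -> nat) :
  (forall j, (j <= k)%N -> (\sum_(b < j.+1) g b * 'C(D - b, j - b) =
                            \sum_(b < j.+1) h b * 'C(D - b, j - b))%N) ->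
  forall j, (j <= k)%N -> g j = h j.
Proof.
move=> e j; elim/ltn_ind: j => j IH jk; have := e j jk.
rewrite !big_ord_recr /= subnn bin0 !muln1 (eq_bigr (fun b : 'I_j => h b * 'C(D - b, j - b))%N).
  by move/addnI.
by move=> b _; rewrite IH // ltnW // (leq_trans (ltn_ord b)).
Qed.

(** The right-hand side is a partial sum in closed form: consecutive values
    differ by the term that is added. *)
Lemma alt_ratio_sum r D K : (K <= D)%N ->
  (D + r).+1%:R / D.+1%:R *
    (\sum_(b < K.+1) (-1) ^+ b * 'C(r + b - 1, b)%:R / 'C(D, b)%:R) =
  1 + (-1) ^+ K * 'C(r + K, K.+1)%:R / 'C(D.+1, K.+1)%:R :> rat.
Proof.
have nz n : n.+1%:R != 0 :> rat by rewrite pnatr_eq0.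
elim: K => [|K IH] KD.
  rewrite big_ord1 !bin0 expr0 !mul1r ?divr1 ?mulr1 addn0 !bin1.
  by rewrite -addSn natrD; field; rewrite addrC natr1; apply: nz.
rewrite big_ord_recr /= mulrDr IH ?(ltnW KD) //.
have h1 : ('C(r + K, K.+1) * (r + K.+1) = 'C(r + K.+1, K.+2) * K.+2)%N.
  by rewrite addnS mulnC mul_bin_diag mulnC.
have h2 : ('C(D, K.+1) * D.+1 = 'C(D.+1, K.+2) * K.+2)%N.
  by rewrite mulnC mul_bin_diag mulnC.
have h3 : ('C(D, K.+1) * D.+1 = 'C(D.+1, K.+1) * (D - K))%N.
  by have := mul_bin_down D.+1 K.+1; rewrite subSS /= => h; rewrite mulnC h mulnC.
have c0 : 'C(D, K.+1)%:R != 0 :> rat by apply: binr_neq0.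
have dk : (D - K)%:R != 0 :> rat by rewrite pnatr_eq0 -lt0n subn_gt0.
have H1 : 'C(r + K.+1, K.+2)%:R = 'C(r + K, K.+1)%:R * (r + K.+1)%:R / K.+2%:R :> rat.
  by rewrite -natrM h1 natrM mulfK ?nz.
have H2 : 'C(D.+1, K.+2)%:R = 'C(D, K.+1)%:R * D.+1%:R / K.+2%:R :> rat.
  by rewrite -natrM h2 natrM mulfK ?nz.
have H3 : 'C(D.+1, K.+1)%:R = 'C(D, K.+1)%:R * D.+1%:R / (D - K)%:R :> rat.
  by rewrite -natrM h3 natrM mulfK.
have -> : (r + K.+1 - 1 = r + K)%N by lia.
rewrite H1 H2 H3.
have eD : D%:R = (D - K)%:R + K%:R :> rat by rewrite -natrD subnK // ltnW.
move: dk eD (nz D) (nz K.+1); rewrite -!natr1 !natrD -!natr1.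
move: (D - K)%:R => x dk -> n1 n2; rewrite exprS; field.
by rewrite n1 n2 c0 dk.
Qed.

Lemma alt_bin_sum n k :
  \sum_(i < k.+1) (-1) ^+ i * 'C(n.+1, i.+1)%:R = 1 + (-1) ^+ k * 'C(n, k.+1)%:R :> rat.
Proof.
elim: k => [|k IH]; first by rewrite big_ord1 expr0 !mul1r !bin1 -natr1 addrC.
rewrite big_ord_recr /= IH [in X in _ + X]binS natrD exprS; ring.
Qed.

Lemma guarded_sum D b (h : nat -> rat) : (b <= D)%N ->
  \sum_(j < D.+1) (guarded_bin D b j)%:R * h j =
  \sum_(i < (D - b).+1) 'C(D - b, i)%:R * h (i + b)%N.
Proof.
move=> bD; rewrite -(big_mkord xpredT (fun j => (guarded_bin D b j)%:R * h j)).
rewrite (big_cat_nat (n := b)) //=; last exact: ltnW.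
rewrite big_nat_cond big1 ?add0r; last first.
  by move=> j; rewrite andbT /= /guarded_bin => jb; rewrite leqNgt jb /= mul0r.
rewrite -{1}(add0n b) big_addn subSn // big_mkord; apply: eq_bigr => i _.
by rewrite /guarded_bin leq_addl addnK.
Qed.

Lemma alt_guarded_sum D b : (b <= D)%N ->
  \sum_(j < D.+1) (guarded_bin D b j)%:R * ((-1) ^+ j / j.+1%:R) =
  (-1) ^+ b / (D.+1%:R * 'C(D, b)%:R) :> rat.
Proof.
move=> bD; rewrite (guarded_sum (fun j => (-1) ^+ j / j.+1%:R)) //.
have := alt_beta (D - b) b; rewrite subnKC // => <-.
rewrite big_distrr /=; apply: eq_bigr => i _.
by rewrite exprD (addnC b); ring.
Qed.

Section Counting.

Variable T : finType.
Implicit Types (Q B : {set {set T}}) (p w t A P : {set T}).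

Lemma sum_by_card Q (h : nat -> rat) N : (forall t, t \in Q -> (#|t| < N)%N) ->
  \sum_(t in Q) h #|t| = \sum_(j < N) #|cells j Q|%:R * h j.
Proof.
move=> hN; rewrite (eq_bigr (fun t => \sum_(j < N | #|t| == j) h j)); last first.
  by move=> t tQ; rewrite (big_pred1 (Ordinal (hN t tQ))) // => j; rewrite eq_sym.
rewrite (exchange_big_dep xpredT) //=; apply: eq_bigr => j _.
rewrite (eq_bigl (fun t => t \in cells j Q)); last by move=> t; rewrite inE.
by rewrite sumr_const mulr_natl.
Qed.

Lemma card_cells_box p w j : p \subset w ->
  #|cells j (box p w)| = guarded_bin #|w| #|p| j.
Proof.
move=> pw; rewrite /guarded_bin; case: leqP => pj; last first.
  apply/eqP; rewrite cards_eq0; apply/eqP/setP => t; rewrite !inE.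
  apply/negbTE/negP => /andP[/andP[/subset_leq_card pt _] /eqP tj]; lia.
have cD : #|w :\: p| = (#|w| - #|p|)%N by rewrite cardsD (setIidPr pw).
rewrite -cD -cards_draws.
rewrite -(card_in_imset (f := fun s : {set T} => p :|: s)); last first.
  move=> s s'; rewrite !inE !subsetD => /andP[/andP[_ ds] _] /andP[/andP[_ ds'] _].
  have h (r : {set T}) : [disjoint r & p] -> (p :|: r) :\: p = r.
    by move=> dr; rewrite setDUl setDv set0U; apply/setDidPl.
  by move=> e; rewrite -(h s ds) e h.
congr #|pred_of_set _|; apply/setP => t; apply/idP/imsetP => [|[s]]; rewrite !inE.
  move=> /andP[/andP[pt tw] /eqP tj]; exists (t :\: p); last first.
    by rewrite -{1}(setID t p) (setIidPr pt).
  by rewrite inE setSD //= cardsD (setIidPr pt) tj.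
rewrite subsetD => /andP[/andP[sw ds] /eqP sj] ->; rewrite subsetUl subUset pw sw /=.
move: ds; rewrite disjoint_sym -leq_card_setU => /eqP ->; rewrite sj; lia.
Qed.

(** Take a subset of [P] by choosing first its size uniformly and then a subset
    of that size uniformly; up to the factor [#|P|.+1], this is the probability
    that it contains [t]. *)
Lemma avg_superset t P : t \subset P ->
  \sum_(A in box t P) ('C(#|P|, #|A|)%:R)^-1 = #|P|.+1%:R / #|t|.+1%:R :> rat.
Proof.
move=> tP; rewrite (sum_by_card (fun a => ('C(#|P|, a)%:R)^-1) (N := #|P|.+1)); last first.
  by move=> A; rewrite inE ltnS => /andP[_ /subset_leq_card].
under eq_bigr do rewrite card_cells_box //.
have tP' := subset_leq_card tP.
by rewrite (guarded_sum (fun a => ('C(#|P|, a)%:R)^-1)) // sum_upper_weights.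
Qed.

End Counting.

(** * The ball bounded by a stellated sphere *)

Section Filling.

Variables (F : fieldType) (T : finType) (sg : {set T} -> T -> F).
Hypothesis sgP : incidence sg.
Implicit Types (S Q B X Y : {set {set T}}) (a b w t A P : {set T}).

(** A ball [B] of dimension 2[k] + 1 with boundary [S]: it is glued from full
    simplices on 2[k] + 2 points, one for the initial sphere and one for each
    bistellar move.  For positive [i], [g i] is the number of moves in which
    [b] has [i] points; [fill_count] sorts the faces of [B] by the simplex in
    which they first occur. *)
Record filling k S B (g : nat -> nat) : Prop := Filling {
  fill_complex : is_complex B;
  fill_sub : S \subset B;
  fill_skeleton : forall t, t \in B -> (#|t| <= k.+1)%N -> t \in S;
  fill_vanishes : forall A n, (k < n)%N -> vanishes sg n (induced B A);
  fill_bound : forall t, t \in B -> (#|t| <= k.*2.+2)%N;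
  fill_g0 : g 0%N = 1%N;
  fill_count : forall j,
    #|cells j B| = (\sum_(i < k.+1) g i * guarded_bin k.*2.+2 i j)%N }.

Lemma bdsimplex_filling k (c : {set T}) : #|c| = k.*2.+2 ->
  filling k (bdsimplex c) (powerset c) (fun i => i == 0%N).
Proof.
move=> cD; split=> //.
- exact: powerset_complex.
- by apply/subsetP => t; rewrite !inE => /andP[].
- move=> t; rewrite !inE => tc tk; rewrite tc andbT.
  by apply: contraTneq tk => ->; rewrite cD; lia.
- move=> A n kn; have -> : induced (powerset c) A = box set0 (c :&: A).
    by apply/setP => t; rewrite !inE sub0set subsetI.
  by apply: box_vanishes => //; rewrite cards0; lia.
- by move=> t; rewrite inE => /subset_leq_card; rewrite cD.
move=> j; rewrite big_ord_recl big1 ?addn0 /= ?mul1n // -{1}cD.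
have -> : powerset c = box set0 c by apply/setP => t; rewrite !inE sub0set.
by rewrite card_cells_box ?sub0set // cards0.
Qed.

(** The faces inside [a :|: b] that are new to [B] are exactly those above [b].
    Indeed, if [b] were in [B] then, having at most [k] points, it would be in
    [X].  A box with least face [b] is then added, and this does not affect
    homology above degree [k].  The faces that leave the boundary sphere lie
    above [a], so they have at least [k] + 2 points. *)
Lemma flip_filling k a b X Y B g : flip a b X Y -> is_complex X ->
  (#|a| + #|b|)%N = k.*2.+2 -> (#|b| <= k)%N -> filling k X B g ->
  filling k Y (B :|: powerset (a :|: b)) (fun i => g i + (i == #|b|))%N.
Proof.
move=> m cX hN hk [cB /subsetP XB skB vB bB g0 gB].
have wN := flip_card m; have [a0 b0 dab hX hY] := m.
have hB t : t \subset a :|: b -> (t \in B) = ~~ (b \subset t).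
  move=> tw; apply/idP/idP => [tB|bt]; last by apply: XB; rewrite hX.
  apply/negP => bt; have bB' := complex_sub cB tB bt.
  have := skB b bB'; rewrite hX ?subsetUr // subxx; lia.
have ct A := induced_cut A cB hB.
split.
- by apply: complexU => //; apply: powerset_complex.
- apply/subsetP => t; rewrite !inE hY; case: ifP => [_ _|_ /XB ->//].
  by rewrite orbT.
- move=> t; rewrite !inE hY; case: ifP => [tw _ tk|_]; last by rewrite orbF; apply: skB.
  by apply/negP => /subset_leq_card; lia.
- move=> A n kn; apply: (vanishes_cut sgP (ct A)); first exact: vB.
  by apply: box_vanishes => //; lia.
- move=> t; rewrite !inE => /orP[/bB //|/subset_leq_card]; lia.
- by rewrite g0 eq_sym cards_eq0 (negPf b0).
move=> j; have -> : cells j (B :|: powerset (a :|: b)) = cells j B :|: cells j (box b (a :|: b)).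
  apply/setP => t; rewrite !inE; case: (#|t| == j); rewrite ?andbF // !andbT.
  case tw: (t \subset a :|: b); rewrite ?andbF // orbT andbT hB //.
  by case: (b \subset t).
rewrite cardsU; have -> : cells j B :&: cells j (box b (a :|: b)) = set0.
  apply/setP => t; rewrite !inE; apply/negbTE/negP => /andP[/andP[tB _] /andP[/andP[bt tw] _]].
  by move: tB; rewrite hB // bt.
rewrite cards0 subn0 gB card_cells_box ?subsetUr // wN hN.
under [RHS]eq_bigr do rewrite mulnDl.
rewrite big_split /=; congr (_ + _)%N.
have bk : (#|b| < k.+1)%N by [].
rewrite (bigD1 (Ordinal bk)) //= eqxx mul1n big1 ?addn0 // => i.
by rewrite -val_eqE /= => /negPf ->.
Qed.

Lemma filling_exists k (c : {set T}) S : #|c| = k.*2.+2 ->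
  connect (@bistellar_lt T k) (bdsimplex c) S -> exists B g, filling k S B g.
Proof.
move=> cD hc; pose Pr X := exists B g, filling k X B g.
suff [_ //] : sphere sg k.*2.+1 S /\ Pr S.
apply: (stellated_sphere_ind sgP (Pr := Pr) cD _ _ hc).
  by exists (powerset c), (fun i => i == 0%N); apply: bdsimplex_filling.
move=> a b X Y [B [g h]] [cX _ _] _ m hN hk.
by do 2!eexists; apply: flip_filling m cX hN hk h.
Qed.

(** Exactness in all degrees above [k], read off from the top down. *)
Lemma rk_alternating Q k : convex Q -> (forall n, (k < n)%N -> vanishes sg n Q) ->
  (rk sg k.+1 Q)%:R =
  \sum_(t in Q) (if (k < #|t|)%N then (-1) ^+ (#|t| - k.+1) else 0) :> rat.
Proof.
move=> cQ vQ.
have step N : (rk sg k.+1 Q)%:R = \sum_(j < N) #|cells (k.+1 + j)%N Q|%:R * (-1) ^+ j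
    + (-1) ^+ N * (rk sg (k.+1 + N)%N Q)%:R :> rat.
  elim: N => [|N ->]; first by rewrite big_ord0 add0r addn0 expr0 mul1r.
  have /(vanishes_card sgP _ cQ) e := vQ (k.+1 + N)%N (leq_addr _ _).
  rewrite big_ord_recr /= e addnS natrD exprS; ring.
rewrite (step #|T|.+1) (_ : rk sg _ Q = 0%N); last first.
  apply: rk_nocells; apply/setP => t; rewrite !inE andbC.
  have := subset_leq_card (subsetT t); rewrite cardsT; case: eqP => //=; lia.
rewrite mulr0 addr0.
rewrite (sum_by_card (fun i => if (k < i)%N then (-1) ^+ (i - k.+1) else 0)
  (N := (k.+1 + #|T|.+1)%N)); last first.
  by move=> t _; have := subset_leq_card (subsetT t); rewrite cardsT; lia.
rewrite big_split_ord /= [X in _ = X + _]big1 ?add0r => [|i _]; last first.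
  by rewrite ltnNge -ltnS ltn_ord mulr0.
by apply: eq_bigr => i _; rewrite leq_addr addKn.
Qed.

Lemma filling_rank k S B g A : filling k S B g ->
  (rk sg k.+1 (induced S A))%:R =
  \sum_(t in B | t \subset A) (if (k < #|t|)%N then (-1) ^+ (#|t| - k.+1) else 0) :> rat.
Proof.
move=> [cB /subsetP SB skB vB _ _ _].
rewrite (@rk_eq _ _ sg _ _ (induced B A)); last first.
  move=> t tk _; rewrite !inE; case tA: (t \subset A); rewrite ?andbF // !andbT.
  by apply/idP/idP => [/SB|/skB ->].
rewrite rk_alternating; first by apply: eq_bigl => t; rewrite inE.
  exact/convex_induced/complex_convex.
by move=> n; apply: vB.
Qed.

(** By [filling_rank] and [avg_superset] the average is the alternating sum of
    the numbers f(j) / (j + 1) over j > [k], up to a factor, where f(j) counts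
    the faces of [B] with j points.  The part with j at most [k] is known from
    neighbourliness.  This part also determines the numbers [g], by a triangular
    system, and the [g] determine the full alternating sum. *)
Lemma average_rank k (c : {set T}) S : (0 < k)%N -> #|c| = k.*2.+2 ->
  connect (@bistellar_lt T k) (bdsimplex c) S ->
  (forall r : {set T}, r \subset vertices S -> (#|r| <= k)%N -> r \in S) ->
  let m := #|vertices S| in
  \sum_(A in powerset (vertices S)) (rk sg k.+1 (induced S A))%:R / 'C(m, #|A|)%:R =
  'C(m, k.+1)%:R - 'C(m - k - 2, k.+1)%:R / 'C(k.*2.+3, k.+1)%:R :> rat.
Proof.
move=> k0 cD hc nb m; have [B [g hB]] := filling_exists cD hc.
have frk A := filling_rank A hB.
have [cB /subsetP SB skB _ bB g0 gB] := hB.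
set P := vertices S in nb m *; set D := k.*2.+2 in cD gB bB.
have BP t : t \in B -> t \subset P.
  move=> tB; apply/subsetP => y yt; rewrite inE; apply: skB; last by rewrite cards1.
  by apply: complex_sub cB tB _; rewrite sub1set.
have cj j : (j <= k)%N -> #|cells j B| = 'C(m, j).
  move=> jk; rewrite -cards_draws; apply: eq_card => t; rewrite !inE.
  case: eqP => [tj|]; rewrite ?andbF // !andbT; apply/idP/idP => [/BP //|tP].
  by apply: SB; apply: nb => //; rewrite tj.
have gj j : (j <= k)%N -> #|cells j B| = (\sum_(i < j.+1) g i * 'C(D - i, j - i))%N.
  move=> jk; rewrite gB -(big_mkord xpredT (fun i => g i * guarded_bin D i j)%N).
  rewrite (big_cat_nat (n := j.+1)) //= [X in (_ + X)%N]big_nat_cond.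
  rewrite [X in (_ + X)%N]big1 ?addn0; last first.
    by move=> b; rewrite andbT /guarded_bin => /andP[jb _]; rewrite leqNgt jb muln0.
  by rewrite big_mkord; apply: eq_bigr => b _; rewrite /guarded_bin -ltnS ltn_ord.
(* The sphere has at least as many vertices as the simplex on c: this is the
   count of the vertices of B. *)
have mD : (D <= m)%N.
  have := gj 1%N k0; rewrite cj // bin1 => ->.
  by rewrite big_ord_recl /= g0 mul1n subn0 bin1 leq_addr.
have [r mE] : exists r, m = (D + r)%N by exists (m - D)%N; lia.
have gE : forall j, (j <= k)%N -> g j = 'C(r + j - 1, j).
  apply: (triangular_uniq (D := D)) => j jk.
  rewrite -gj // cj // mE vandermonde_multiset 1?addnC //; rewrite /D; lia.
pose al j : rat := (-1) ^+ j / j.+1%:R.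
have total : m.+1%:R * \sum_(t in B) al #|t| =
    1 + (-1) ^+ k * 'C(r + k, k.+1)%:R / 'C(D.+1, k.+1)%:R.
  rewrite (sum_by_card al (N := D.+1)) //.
  under eq_bigr do rewrite gB natr_sum big_distrl /=.
  rewrite exchange_big /= -alt_ratio_sum; last by rewrite /D; lia.
  rewrite -mE -mulrA; congr (_ * _); rewrite big_distrr /=; apply: eq_bigr => b _.
  have bk := ltn_ord b.
  under eq_bigr do rewrite natrM -mulrA.
  rewrite -big_distrr /= alt_guarded_sum; last by rewrite /D; lia.
  by rewrite gE // invfM; ring.
have low : m.+1%:R * \sum_(j < k.+1) #|cells j B|%:R * al j =
    1 + (-1) ^+ k * 'C(m, k.+1)%:R.
  rewrite -alt_bin_sum big_distrr /=; apply: eq_bigr => j _.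
  have jk : (j <= k)%N by rewrite -ltnS.
  rewrite cj // /al; have h : (m.+1 * 'C(m, j) = j.+1 * 'C(m.+1, j.+1))%N.
    by rewrite mul_bin_diag.
  have -> : 'C(m.+1, j.+1)%:R = m.+1%:R * 'C(m, j)%:R / j.+1%:R :> rat.
    by rewrite -natrM h natrM mulrAC divff ?mul1r // pnatr_eq0.
  by ring.
transitivity (m.+1%:R * \sum_(t in B)
  (if (k < #|t|)%N then (-1) ^+ (#|t| - k.+1) / #|t|.+1%:R else 0) : rat).
  under eq_bigr do rewrite frk big_distrl /=.
  rewrite (exchange_big_dep (mem B)) /=; last by move=> A t _ /andP[].
  rewrite big_distrr /=; apply: eq_bigr => t tB; rewrite -big_distrr /=.
  have e : \sum_(A in powerset P | t \subset A) ('C(m, #|A|)%:R)^-1 =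
           m.+1%:R / #|t|.+1%:R :> rat.
    by rewrite -avg_superset ?BP //; apply: eq_bigl => A; rewrite !inE andbC.
  rewrite (eq_bigl (fun A => (A \in powerset P) && (t \subset A))) ?e; last first.
    by move=> A; rewrite tB.
  by case: ifP => _; [ring | rewrite mul0r mulr0].
pose h j : rat := if (k < j)%N then (-1) ^+ (j - k.+1) / j.+1%:R else 0.
rewrite (sum_by_card h (N := D.+1)) //.
move: total; rewrite (sum_by_card al (N := D.+1)) //.
have -> : D.+1 = (k.+1 + k.+2)%N by rewrite /D; lia.
rewrite !big_split_ord /= [X in _ -> _ * (X + _) = _]big1 ?add0r => [|i _]; last first.
  by rewrite /h ltnNge -ltnS ltn_ord mulr0.
rewrite mulrDr low => tot.
have -> : \sum_(i < k.+2) #|cells (k.+1 + i)%N B|%:R * h (k.+1 + i)%N =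
    (-1) ^+ k.+1 * \sum_(i < k.+2) #|cells (k.+1 + i)%N B|%:R * al (k.+1 + i)%N :> rat.
  rewrite big_distrr /=; apply: eq_bigr => i _; rewrite /h /al leq_addr addKn exprD.
  have s : (-1) ^+ k.+1 * (-1) ^+ k.+1 = 1 :> rat by rewrite -expr2 sqrr_sign.
  by rewrite -[LHS]mul1r -[X in X * _ = _]s; ring.
have s : (-1) ^+ k * (-1) ^+ k = 1 :> rat by rewrite -expr2 sqrr_sign.
rewrite mulrCA; move: tot => /(canRL (addKr _)) ->.
have -> : (m - k - 2 = r + k)%N by rewrite mE /D; lia.
by rewrite exprS -[RHS]mul1r -[X in _ = X * _]s; ring.
Qed.

End Filling.

(** * The middle degree *)

Section Telescope.

Variables (V : finType) (P : {set V}).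
Implicit Types (W : {set V}) (x : V).
Local Notation n := #|P|.
Hypothesis n0 : (0 < n)%N.

(** The probability that, in a random ordering of [P], the vertices before a
    given one are exactly those of a given set of size [a]. *)
Definition step_weight (a : nat) : rat := (n%:R * 'C(n.-1, a)%:R)^-1.

Lemma step_weight_up a : (a < n)%N -> (n - a)%:R * step_weight a = ('C(n, a)%:R)^-1.
Proof.
move=> an; have h := mul_bin_down n a.
rewrite /step_weight -natrM h natrM invfM mulVKf // pnatr_eq0; lia.
Qed.

Lemma step_weight_down a : (0 < a <= n)%N -> a%:R * step_weight a.-1 = ('C(n, a)%:R)^-1.
Proof.
case: a => // a /= an; have h := mul_bin_diag n a.
by rewrite /step_weight -natrM h natrM invfM mulVKf // pnatr_eq0.
Qed.

(** The expected total increase of [b] along a random ordering of [P]: in the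
    sum, a set other than [set0] and [P] occurs with equal weights as the end
    of a step and as the beginning of one. *)
Lemma telescope (b : {set V} -> rat) :
  \sum_(x in P) \sum_(W in powerset (P :\ x)) step_weight #|W| * (b (x |: W) - b W) =
  b P - b set0.
Proof.
pose up W := if W == P then 0 else ('C(n, #|W|)%:R)^-1 : rat.
pose dn W := if W == set0 then 0 else ('C(n, #|W|)%:R)^-1 : rat.
have sub W x : (W \in powerset (P :\ x)) = (W \subset P) && (x \notin W).
  by rewrite inE subsetD1.
have e1 : \sum_(x in P) \sum_(W in powerset (P :\ x)) step_weight #|W| * b (x |: W) =
    \sum_(W in powerset P) dn W * b W.
  transitivity (\sum_(x in P) \sum_(W in powerset P | x \in W) step_weight #|W|.-1 * b W).
    apply: eq_bigr => x xP; rewrite [RHS](reindex_onto (fun W => x |: W) (fun W => W :\ x)) /=.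
      apply: eq_big => [W|W]; last first.
        by rewrite sub => /andP[_ xW]; rewrite cardsU1 xW.
      rewrite sub inE subUset sub1set xP setU11 andbT /=; congr (_ && _).
      apply/idP/eqP => [xW|<-]; first by rewrite setU1K.
      by rewrite setD11.
    by move=> W /andP[_ xW]; rewrite setD1K.
  rewrite (exchange_big_dep (mem (powerset P))) /=; last by move=> x W _ /andP[].
  apply: eq_bigr => W WP; rewrite WP /=; rewrite inE in WP.
  rewrite (eq_bigl (mem W)); last first.
    by move=> x /=; apply: andb_idl; apply: (subsetP WP).
  rewrite sumr_const -mulr_natl mulrA; congr (_ * _); rewrite /dn.
  case: eqP => [->|/eqP Wn]; first by rewrite cards0 mul0r.
  by rewrite step_weight_down // card_gt0 Wn subset_leq_card.
have e2 : \sum_(x in P) \sum_(W in powerset (P :\ x)) step_weight #|W| * b W =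
    \sum_(W in powerset P) up W * b W.
  rewrite (exchange_big_dep (mem (powerset P))) /=; last first.
    by move=> x W _; rewrite sub inE => /andP[].
  apply: eq_bigr => W; rewrite inE => WP.
  rewrite (eq_bigl (mem (P :\: W))); last by move=> x; rewrite sub WP !inE andbC.
  rewrite sumr_const cardsD (setIidPr WP) -mulr_natl mulrA; congr (_ * _); rewrite /up.
  case: eqP => [->|/eqP WnP]; first by rewrite subnn mul0r.
  by rewrite step_weight_up // proper_card // properEneq WnP.
under eq_bigr => x _ do under eq_bigr => W _ do rewrite mulrBr.
under eq_bigr => x _ do rewrite sumrB.
rewrite sumrB e1 e2 -sumrB.
have P0 : (P == set0) = false by apply/negbTE; rewrite -card_gt0.
rewrite (bigD1 P) ?inE //= (bigD1 set0) /=; last by rewrite inE sub0set eq_sym P0.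
rewrite /up /dn !eqxx P0 eq_sym P0 cards0 binn bin0 invr1 !mul1r !mul0r subr0 sub0r.
rewrite big1 ?addr0 // => W /andP[/andP[_ /negPf -> ] /negPf ->]; exact: subrr.
Qed.

End Telescope.

Section LinkAverage.

Variables (F : fieldType) (V : finType) (M : {set {set V}}) (k : nat) (x : V).
Implicit Types (s t W : {set V}) (y : V).
Hypothesis cM : is_complex M.
Hypothesis hL : stellatedS k k.*2.+1 (link M x).
Hypothesis k0 : (0 < k)%N.
Local Notation sg := (@enum_sign F V).
Local Notation P := (vertices M).
Hypothesis neM : forall r : {set V}, r \subset P -> (#|r| <= k.+1)%N -> r \in M.
Hypothesis xP : x \in P.

Let sgP : incidence sg := @enum_sign_incidence F V.

Lemma link_vertices : vertices (link M x) = P :\ x.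
Proof.
apply/setP => y; rewrite !inE eq_sym; case: eqP => [->|/eqP yx] /=; first by rewrite andbF.
apply: andb_idr => yP; apply: neM; last by rewrite cards2; case: (x != y).
by rewrite subUset !sub1set xP inE.
Qed.

(** [average_rank] for the link of [x], read in the open star of [x]; all other
    vertices are in the link because any two vertices form an edge. *)
Lemma link_average :
  \sum_(W in powerset (P :\ x)) (rk sg k.+2 (star_in M [set x] W))%:R / 'C(#|P|.-1, #|W|)%:R =
  'C(#|P|.-1, k.+1)%:R - 'C(#|P|.-1 - k - 2, k.+1)%:R / 'C(k.*2.+3, k.+1)%:R :> rat.
Proof.
have [U [f [c [sgU [fN cd hc iU eU]]]]] := link_model F hL.
set L := link M x in fN hc eU; set N := vertices L in fN eU.
have LN t : t \in L -> t \subset N := link_sub cM (t := t).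
have xN : x \notin N := notin_link M x.
have nP : #|P|.-1 = #|N| by rewrite /N link_vertices (card_setD1 xP).
have cf s : s \subset N -> #|f @: s| = #|s|.
  by move=> sN; apply: card_in_imset => y z ys zs; apply: fN; apply: (subsetP sN).
have vS : vertices (relabel f L) = f @: N.
  apply/setP => u; rewrite inE; apply/imsetP/imsetP => [[s sL e]|[y]].
    have := cards1 u; rewrite e cf ?LN // => /eqP/cards1P[y sy].
    exists y; first by rewrite inE -sy.
    by move/setP/(_ u): e; rewrite sy imset_set1 !inE eqxx => /esym/eqP.
  by rewrite inE => yL ->; exists [set y]; rewrite // imset_set1.
have nb (r : {set U}) : r \subset vertices (relabel f L) -> (#|r| <= k)%N -> r \in relabel f L.
  rewrite vS => rN rk_; pose s := [set y in N | f y \in r].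
  have sN : s \subset N by apply/subsetP => y; rewrite inE => /andP[].
  have fs : f @: s = r.
    apply/setP => u; apply/imsetP/idP => [[y]|ur]; first by rewrite inE => /andP[_ ? ->].
    by have /imsetP[y yN e] := subsetP rN u ur; exists y; rewrite // inE yN -e.
  apply/imsetP; exists s => //; rewrite -fs cf // in rk_.
  have xs : x \notin s by apply: contra xN; apply: (subsetP sN).
  have sP : s \subset P by apply: subset_trans sN _; rewrite /N link_vertices subD1set.
  have sM : s \in M by apply: neM => //; apply: leqW.
  rewrite inE sM xs /=.
  by apply: neM; [rewrite subUset sub1set xP | rewrite cardsU1 xs; lia].
have := average_rank iU k0 cd hc nb; rewrite /= vS cf // -nP => <-.
have -> : powerset (f @: N) = [set f @: (W : {set V}) | W in powerset N].
  apply/setP => A; rewrite inE; apply/idP/imsetP => [AN|[W]]; last first.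
    by rewrite inE => WN ->; apply: imsetS.
  exists [set y in N | f y \in A]; first by rewrite inE; apply/subsetP => y; rewrite inE => /andP[].
  apply/setP => u; apply/idP/imsetP => [uA|[y]]; last by rewrite inE => /andP[_ ? ->].
  by have /imsetP[y yN e] := subsetP AN u uA; exists y; rewrite // inE yN -e.
rewrite big_imset /=; last first.
  by move=> W W'; rewrite !inE => WN W'N; apply: (imset_injN fN).
rewrite -link_vertices; apply: eq_bigr => W; rewrite inE => WN.
rewrite cf //; congr (_%:R / _).
have -> : induced (relabel f L) (f @: W) = relabel f (induced L W).
  by rewrite relabel_induced // (setIidPl WN).
rewrite star_in_coned //; apply: (rk_transport xN fN _ eU).
by move=> t; rewrite inE => /andP[/LN].
Qed.

End LinkAverage.

Section Betti.

Variables (F : fieldType) (V : finType) (M : {set {set V}}) (k : nat).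
Hypothesis cM : is_complex M.
Local Notation sg := (@enum_sign F V).
Local Notation P := (vertices M).
Hypothesis k0 : (0 < k)%N.
Hypothesis neM : forall r : {set V}, r \subset P -> (#|r| <= k.+1)%N -> r \in M.

Let sgP : incidence sg := @enum_sign_incidence F V.

Lemma rk_powerset (A : {set V}) j : A != set0 -> rk sg j.+1 (powerset A) = 'C(#|A|.-1, j).
Proof.
case/set0Pn => y yA; have ac := full_acyclic sgP yA.
have cv := complex_convex (powerset_complex A).
have e i : 'C(#|A|, i) = (rk sg i (powerset A) + rk sg i.+1 (powerset A))%N.
  rewrite -(vanishes_card sgP i cv).1 // -cards_draws; apply: eq_card => t.
  by rewrite !inE.
have A1 : #|A| = #|A|.-1.+1 by rewrite prednK // (cardD1 y) yA.
elim: j => [|j IH]; first by have := e 0%N; rewrite !bin0 rk0 add0n => <-.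
have := e j.+1; rewrite IH {1}A1 binS addnC => /addnI; exact: esym.
Qed.

(** The complete [k]-skeleton fixes the rank of the boundary map in dimension
    [k], as in a full simplex. *)
Lemma betti_rk (p0 : P != set0) :
  (betti F k M + rk sg k.+2 M)%N = 'C(#|P|.-1, k.+1).
Proof.
have bR : boundaries F k M = (linfun (rbd sg M) @: span_cells F (cells k.+2 M))%VS.
  rewrite /boundaries chainsE; apply: eq_in_limg => b bn.
  by rewrite (boundary_rbd cM bn) lfunE.
have sB : (boundaries F k M <= cycles F k M)%VS.
  apply/subvP => c /(boundariesP _ _ cM)[b bn ->]; apply: (rbd_cycle cM bn).
  exact: span_cellsW (rbd_span_n _ _ bn).
have e1 : (\dim (boundaries F k M) + betti F k M)%N = \dim (cycles F k M).
  have := dimv_cap_compl (cycles F k M) (boundaries F k M).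
  by rewrite (capv_idPr sB) /betti /homology dimvf.
have e2 : (\dim (cycles F k M) + rk sg k.+1 M)%N = #|cells k.+1 M|.
  rewrite -(dim_span_cells F) -[RHS](limg_ker_dim (boundary F V)) /cycles chainsE.
  congr (_ + \dim _)%N.
  apply: eq_in_limg => b; case: k k0 => // k' _ bn.
  by rewrite (boundary_rbd cM bn) lfunE.
have e3 : rk sg k.+1 M = 'C(#|P|.-1, k).
  rewrite -rk_powerset //; apply: rk_eq => t tk _; rewrite inE.
  by apply/idP/idP => [/(faces_sub cM)|/neM ->].
have e4 : #|cells k.+1 M| = 'C(#|P|, k.+1).
  rewrite -cards_draws; apply: eq_card => t; rewrite !inE;
  case: eqP => [tk|]; rewrite ?andbF // !andbT.
  by apply/idP/idP => [/(faces_sub cM)|/neM ->] //; rewrite tk.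
have p1 : #|P| = #|P|.-1.+1 by rewrite prednK // card_gt0.
rewrite addnC /rk -bR e1; apply: (@addIn (rk sg k.+1 M)).
by rewrite e2 e3 e4 {1}p1 binS.
Qed.

End Betti.

Section MiddleDegree.

Variables (F : fieldType) (V : finType) (M : {set {set V}}) (k : nat).
Implicit Types (W : {set V}) (x : V).
Hypothesis cM : is_complex M.
Hypothesis dM : dimS M = k.*2.+2.
Hypothesis k0 : (0 < k)%N.
Local Notation sg := (@enum_sign F V).
Local Notation P := (vertices M).
Hypothesis neM : forall r : {set V}, r \subset P -> (#|r| <= k.+1)%N -> r \in M.
Hypothesis stM : forall x, x \in P -> stellatedS k k.*2.+1 (link M x).

Let sgP : incidence sg := @enum_sign_incidence F V.

Lemma vertices_bound : (k.*2.+2 <= #|P|)%N.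
Proof.
by rewrite -dM; have [t tM <-] := dimS_ex cM; apply/subset_leq_card/faces_sub.
Qed.

Lemma injects_steps :
  (forall W, injects sg k.+1 (induced M W) M) <->
  (forall x W, x \in P -> W \subset P :\ x ->
     injects sg k.+1 (induced M W) (induced M (x |: W))).
Proof.
split=> [h x W xP WP|h W].
  exact (injects_sub (induced_full_cut cM (x |: W)) (h W)).
rewrite (induced_vertices cM) -[X in injects _ _ _ X](induced_all cM).
have := subsetIr W P; move: (W :&: P) => {}W WP.
pose Pr W' := injects sg k.+1 (induced M W') (induced M P).
apply: (extend_ind (Pr := Pr) WP); first exact: injects_refl.
move=> W' x xW xP; apply: injects_trans; first exact/induced_sub/subsetUr.
move: xP; rewrite subUset sub1set => /andP[xP W'P].
by apply: h; rewrite // subsetD1 W'P.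
Qed.

(** The weighted sum [total] of the defects in [rk_cut] is the difference of the
    two sides.  The weights are positive and the defects nonnegative, so it is
    zero exactly when every step is injective. *)
Lemma injects_betti :
  (forall W, injects sg k.+1 (induced M W) M) <->
  (betti F k M)%:R = 'C(#|P| - k - 3, k.+1)%:R / 'C(k.*2.+3, k.+1)%:R :> rat.
Proof.
have nP : (0 < #|P|)%N by apply: leq_trans vertices_bound.
pose r W : rat := (rk sg k.+2 (induced M W))%:R.
pose q x W : rat := (rk sg k.+2 (star_in M [set x] W))%:R.
pose w W := step_weight P #|W|.
have w0 W x : x \in P -> W \subset P :\ x -> 0 < w W.
  move=> xP WP; rewrite /w /step_weight invr_gt0 -natrM ltr0n muln_gt0 nP bin_gt0.
  by have := subset_leq_card WP; rewrite (card_setD1 xP).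
have d0 x W : x \in P -> W \subset P :\ x -> 0 <= r (x |: W) - r W - q x W.
  move=> xP; rewrite subsetD1 => /andP[_ xW].
  have [le _] := rk_cut sg (vertex_cut cM xW) k.+1.
  by rewrite -addrA -opprD subr_ge0 -natrD ler_nat.
have d0E x W : x \in P -> W \subset P :\ x ->
    r (x |: W) - r W - q x W = 0 <-> injects sg k.+1 (induced M W) (induced M (x |: W)).
  move=> xP; rewrite subsetD1 => /andP[_ xW].
  have [_ <-] := rk_cut sg (vertex_cut cM xW) k.+1.
  rewrite -addrA -opprD -natrD; split=> [/eqP|->]; last by rewrite subrr.
  by rewrite subr_eq0 eqr_nat => /eqP.
have total : \sum_(x in P) \sum_(W in powerset (P :\ x)) w W * (r (x |: W) - r W - q x W) =
    'C(#|P| - k - 3, k.+1)%:R / 'C(k.*2.+3, k.+1)%:R - (betti F k M)%:R.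
  under eq_bigr => x _ do under eq_bigr => W _ do rewrite mulrBr.
  under eq_bigr => x _ do rewrite sumrB.
  rewrite sumrB telescope //.
  have -> : r set0 = 0.
    rewrite /r rk_nocells //; apply/setP => t; rewrite !inE subset0.
    by case: eqP => [->|]; rewrite ?andbF // cards0 andbF.
  have -> : \sum_(x in P) \sum_(W in powerset (P :\ x)) w W * q x W =
     'C(#|P|.-1, k.+1)%:R - 'C(#|P|.-1 - k - 2, k.+1)%:R / 'C(k.*2.+3, k.+1)%:R.
    rewrite (eq_bigr (fun=> #|P|%:R^-1 *
      ('C(#|P|.-1, k.+1)%:R - 'C(#|P|.-1 - k - 2, k.+1)%:R / 'C(k.*2.+3, k.+1)%:R))).
      by rewrite sumr_const -[LHS]mulr_natl mulVKf // pnatr_eq0 -lt0n.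
    move=> x xP; rewrite -(link_average F cM (stM xP) k0 neM xP) big_distrr /=.
    by apply: eq_bigr => W _; rewrite /w /step_weight invfM /q; ring.
  rewrite /r induced_all // -(@betti_rk F V M k) // -?card_gt0 // natrD.
  have -> : (#|P|.-1 - k - 2 = #|P| - k - 3)%N by lia.
  by ring.
rewrite injects_steps; split=> [h|e].
  apply/esym/eqP; rewrite -subr_eq0 -total; apply/eqP.
  apply: big1 => x xP; apply: big1 => W; rewrite inE => WP.
  by rewrite (d0E x W xP WP).2 ?mulr0 //; apply: h.
move=> x W xP WP; apply/(d0E x W xP WP).
have t0 y A : y \in P -> A \in powerset (P :\ y) -> 0 <= w A * (r (y |: A) - r A - q y A).
  by move=> yP; rewrite inE => AP; rewrite mulr_ge0 ?d0 // ltW // (w0 _ y).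
have t1 y : y \in P -> 0 <= \sum_(A in powerset (P :\ y)) w A * (r (y |: A) - r A - q y A).
  by move=> yP; apply: sumr_ge0 => A; apply: t0.
have := total; rewrite e subrr => /(psumr_eq0P t1)/(_ x xP).
move/(psumr_eq0P (fun A => t0 x A xP))/(_ W); rewrite inE => /(_ WP)/eqP.
by rewrite mulf_eq0 gt_eqF ?(w0 _ x) //= => /eqP.
Qed.

End MiddleDegree.

(* In (b) the case k = 0, d = 1 must be excluded: the triangle graph (n = 3) is
   tight, but beta_0 = 1 while the quotient of binomials is 0. *)
Theorem theorem3p10 (F : fieldType) (V : finType) (M : {set {set V}})
    (k d : nat) (hkd : (k <= d)%N)
    (hM : in_Wstar k d M) (hor : orientable F d M) :
  (d <> (2 * k + 1)%N -> tight F M) /\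
  (d = (2 * k + 1)%N -> (0 < k)%N ->
     (tight F M <->
      (betti F k M)%:R =
        'C(#|vertices M| - k - 3, k.+1)%:R / 'C(2 * k + 3, k.+1)%:R :> rat)).
Proof.
have [[cM dM conn stM] nM] := hM.
have kM : (k.+1 <= dimS M)%N by rewrite dM.
have neM := neighbourly_faces cM kM nM.
have inj j W : (j < d.+1)%N -> j <> k \/ d <> (2 * k).+1 ->
    injects (enum_sign F (V := V)) j.+1 (induced M W) M.
  exact: all_injects.
split=> [hd|hd k0].
  apply/(tightE F cM conn) => W j; rewrite dM => jd.
  by apply: inj => //; right; rewrite -addn1.
have e1 : (2 * k + 1)%N = k.*2.+1 by lia.
have e3 : (2 * k + 3)%N = k.*2.+3 by lia.
rewrite e3; rewrite hd e1 in dM stM.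
rewrite -(injects_betti F cM dM k0 neM stM) (tightE F cM conn) dM.
split=> [h W|h W j jk]; first by apply: h; lia.
have [->|/eqP njk] := eqVneq j k; first exact: h.
by apply: inj; [rewrite hd e1 | left].
Qed.
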